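(* Let $\mu,\nu$ be random probability measures on $\mathbb{R}$. Then $\mu$ and $\nu$ have the same distribution provided any of the following holds (where $=_d$ denotes equality of joint distributions of the indexed families): \begin{enumerate} \item $(\phi_\mu(t))_{t\in\mathbb{R}}=_d(\phi_\nu(t))_{t\in\mathbb{R}}$; \item $\mu,\nu\in P^+$ a.s. and $(\mathcal{L}_\mu(s))_{s\ge0}=_d(\mathcal{L}_\nu(s))_{s\ge0}$; \item $\mu,\nu\in M_{<\infty}$ a.s. and $(\mathcal{M}_\mu(s))_{s\in\mathbb{R}}=_d(\mathcal{M}_\nu(s))_{s\in\mathbb{R}}$ (where the value $\infty$ is possible for some $s$ and some sample points); \item $\mu,\nu\in\mathfrak{C}$ a.s. and $(\mu_k)_{k\ge0}=_d(\nu_k)_{k\ge0}$. \end{enumerate}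
   Context: $P(\mathbb{R})$ denotes the set of Borel probability measures on $\mathbb{R}$, with the $\sigma$-algebra generated by the maps $\mu\mapsto\mu(B)$, $B\subset\mathbb{R}$ Borel. A random probability measure is a random variable with values in $P(\mathbb{R})$. For a (possibly random) probability measure $\mu$: $\phi_\mu(t)=\int_{\mathbb{R}}e^{itx}\,d\mu(x)$, $t\in\mathbb{R}$; $\mathcal{L}_\mu(s)=\int_{[0,\infty)}e^{-sx}\,d\mu(x)$, $s\ge0$; $\mathcal{M}_\mu(s)=\int_{\mathbb{R}}e^{sx}\,d\mu(x)\in[0,\infty]$, $s\in\mathbb{R}$; $\mu_k=\int_{\mathbb{R}}x^k\,d\mu(x)$ when it exists. $P^+$ is the set of $\mu\in P(\mathbb{R})$ supported in $[0,\infty)$. $M_{<\infty}$ is the set of $\mu\in P(\mathbb{R})$ whose moment generating function $\mathcal{M}_\mu$ is finite in some neighborhood of $0$ (depending on $\mu$). $\mathfrak{C}$ is the set of $\mu\in P(\mathbb{R})$ all of whose moments exist and are finite and which satisfy Carleman's condition $\sum_{j=1}^\infty 1/\mu_{2j}^{1/(2j)}=\infty$, with the convention $1/0=\infty$. *)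

(* Defs.v *)
From HB Require Import structures.
From mathcomp Require Import all_boot all_order all_algebra complex.
From mathcomp Require Import all_classical all_reals all_analysis.
From mathcomp Require Import measurable_realfun.
Set Implicit Arguments.
Unset Strict Implicit.
Unset Printing Implicit Defensive.
Import Order.TTheory GRing.Theory Num.Theory.
Import numFieldNormedType.Exports.
Local Open Scope classical_set_scope.
Local Open Scope ring_scope.
Local Open Scope complex_scope.

Section distributions.

(* The quantification is restricted to measurable sets because measures are
   total functions, whose values outside the sigma-algebra are irrelevant. *)
Definition eq_distribution d1 d2 d (Omega1 : measurableType d1)
    (Omega2 : measurableType d2) (E : measurableType d) (R : realType)
    (P : probability Omega1 R) (Q : probability Omega2 R)
    (X : Omega1 -> E) (Y : Omega2 -> E) : Prop :=
  forall A : set E, measurable A -> pushforward P X A = pushforward Q Y A.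

Definition cylinders (I : Type) d (E : measurableType d) : set (set (I -> E)) :=
  [set A | exists i (B : set E), measurable B /\ A = (fun x => x i) @^-1` B].

(* E^I with the product sigma-algebra. *)
Definition product_space (I : Type) d (E : measurableType d) :
    measurableType (@cylinders I d E).-sigma :=
  g_sigma_algebraType (@cylinders I d E).

Definition eq_joint_distribution d1 d2 d (I : Type) (Omega1 : measurableType d1)
    (Omega2 : measurableType d2) (E : measurableType d) (R : realType)
    (P : probability Omega1 R) (Q : probability Omega2 R)
    (X : I -> Omega1 -> E) (Y : I -> Omega2 -> E) : Prop :=
  eq_distribution P Q (fun w => X^~ w : product_space I E)
                      (fun w => Y^~ w : product_space I E).

End distributions.

Section transforms.
Context {R : realType}.
Implicit Type mu : probability R R.

(* The ascription selects the topology of the modulus. *)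
Definition borelC : measurableType (@open (R[i] : numFieldType)).-sigma :=
  g_sigma_algebraType (@open (R[i] : numFieldType)).

Definition expi (y : R) : R[i] := cos y +i* sin y.

Definition Cintegral mu (f : R -> R[i]) : R[i] :=
  (\int[mu]_x complex.Re (f x)) +i* (\int[mu]_x complex.Im (f x)).

Definition char_fun mu (t : R) : borelC := Cintegral mu (fun x => expi (t * x)).

Definition laplace mu (s : {nonneg R}) : R :=
  \int[mu]_(x in `[0, +oo[) expR (- (s%:num * x)).

Definition mgf mu (s : R) : \bar R := 'M_mu id s.

(* Meaningful when x ^+ k is mu-integrable; a junk value otherwise. *)
Definition moment mu (k : nat) : R := \int[mu]_x (x ^+ k).

Definition supported_nonneg : set (probability R R) :=
  [set mu : probability R R | mu `[0, +oo[%classic = 1%E].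

Definition finite_mgf : set (probability R R) :=
  [set mu : probability R R | \forall s \near (0 : R), (mgf mu s < +oo)%E].

(* The inverse in \bar R satisfies 0^-1 = +oo. *)
Definition carleman : set (probability R R) :=
  [set mu : probability R R |
    (forall k : nat, mu.-integrable setT (fun x => (x ^+ k)%:E)) /\
    (\sum_(1 <= j <oo)
       ((moment mu (2 * j) `^ ((2 * j)%:R^-1))%:E)^-1 = +oo)%E].

End transforms.
Arguments borelC R : clear implicits.

(* Main.v *)
(** Call [f] observable if the integral of [f] against the random measure is a
    measurable function of the given transform.  Observable functions are
    closed under linear combinations and bounded pointwise limits.  If [F n]
    tends pointwise to the identity and all the powers of [F n] are observable,
    then so is [exp (- exp (a (F n - c)))], by power series, and letting [n]
    and then [a] tend to infinity gives the indicators of half-lines.  Hence the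
    sigma-algebra on measures is, on the class where the transform is assumed
    to live, the trace of the one generated by the transform, and equality in
    law of the transforms gives equality in law of the measures.

    One takes [n sin (x / n)] for the characteristic function,
    [n (1 - exp (- x / n))] for the Laplace transform, and [n^2 x / (x^2 + n^2)]
    for the moments.  In the last case the Cauchy integrals of [1 / (x - ib)] have
    to be recovered from the moments.  If [p_k] are the orthonormal polynomials,
    the square of the L2 distance from [1] to the multiples of [X - ib] is the
    inverse of [sum_k |p_k (ib)|^2].  By a Wronskian identity this sum is
    at least [b] times the sum of the [h_k^(1/2) / h_(k+1)^(1/2)], where [h_k] is
    the square norm of the [k]-th monic orthogonal polynomial.  As
    [h_k <= mu_(2k)], Carleman's inequality makes it diverge.  So
    [1 / (x - ib)] is an L2 limit of polynomials, which can be taken rational and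
    can be selected by looking at the moments only.

    A moment generating function finite near 0 gives the moments as limits of
    difference quotients, and factorial growth implies Carleman's condition. *)

Require Import Defs.
From HB Require Import structures.
From mathcomp Require Import all_boot all_order all_algebra complex.
From mathcomp Require Import all_classical all_reals all_analysis.
From mathcomp Require Import measurable_realfun.
From mathcomp Require Import ring lra.
Set Implicit Arguments.
Unset Strict Implicit.
Unset Printing Implicit Defensive.
Import Order.TTheory GRing.Theory Num.Theory.
Import numFieldNormedType.Exports.
Local Open Scope classical_set_scope.
Local Open Scope ring_scope.

(** * Observable functions *)

Section observables.
Context d (T : measurableType d) (R : realType) (M : T -> probability R R).

(** Boundedness makes [f] integrable for every probability measure, so the integral never takes a
    default value and dominated convergence applies. *)
Record observable (f : R -> R) : Prop := Observable {
  observable_measurable : measurable_fun setT f ;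
  observable_bounded : exists C, forall x, `|f x| <= C ;
  observable_Rintegral : measurable_fun setT (fun t => \int[M t]_x f x) }.

Lemma bounded_integrable (m : probability R R) (f : R -> R) (C : R) :
  measurable_fun setT f -> (forall x, `|f x| <= C) ->
  m.-integrable setT (EFin \o f).
Proof.
move=> mf fC; apply: measurable_bounded_integrable => //.
  by rewrite (le_lt_trans (probability_le1 _ _))// ltry.
by exists C; split; rewrite ?num_real// => x Cx y _; exact: le_trans (fC y) (ltW Cx).
Qed.

Lemma observable_integrable f t : observable f ->
  (M t).-integrable setT (EFin \o f).
Proof. by case=> mf [C fC] _; exact: bounded_integrable fC. Qed.

Lemma observable_cst c : observable (cst c).
Proof.
split; [exact: measurable_cst|by exists (`|c|)|].
rewrite (_ : (fun t => _) = cst c)//.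
apply/funext => t; rewrite Rintegral_cst//.
by rewrite [X in fine X](_ : _ = 1%E) ?mulr1//; exact: probability_setT.
Qed.

Lemma observableZ a f : observable f -> observable (fun x => a * f x).
Proof.
move=> of_; have [mf [C fC] If] := of_; split.
- exact: measurable_funM.
- by exists (`|a| * C) => x; rewrite normrM ler_wpM2l.
- rewrite (_ : (fun t => _) = (fun t => a * \int[M t]_x f x)).
    by apply: measurable_funM.
  by apply/funext => t; rewrite RintegralZl//; exact: observable_integrable.
Qed.

Lemma observableD f g : observable f -> observable g ->
  observable (fun x => f x + g x).
Proof.
move=> of_ og; have [mf [C fC] If] := of_; have [mg [C' gC] Ig] := og; split.
- exact: measurable_funD.
- by exists (C + C') => x; rewrite (le_trans (ler_normD _ _))// lerD.
- rewrite (_ : (fun t => _) = (fun t => \int[M t]_x f x + \int[M t]_x g x)).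
    by apply: measurable_funD.
  by apply/funext => t; rewrite RintegralD//; exact: observable_integrable.
Qed.

Lemma observableB f g : observable f -> observable g ->
  observable (fun x => f x - g x).
Proof.
move=> of_ og.
rewrite (_ : (fun x => _) = (fun x => f x + (- 1) * g x)).
  by apply: observableD => //; exact: observableZ.
by apply/funext => x; rewrite mulN1r.
Qed.

Lemma eq_observable f g : f =1 g -> observable f -> observable g.
Proof. by move=> /funext ->. Qed.

Lemma observable_sum (I : Type) (s : seq I) (F : I -> R -> R) :
  (forall i, observable (F i)) -> observable (fun x => \sum_(i <- s) F i x).
Proof.
move=> oF; elim: s => [|i s IHs].
  by apply: eq_observable (observable_cst 0) => x; rewrite big_nil.
by apply: eq_observable (observableD (oF i) IHs) => x; rewrite big_cons.
Qed.

Lemma bounded_convergence (m : probability R R) (F : nat -> R -> R)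
    (f : R -> R) (C : R) :
  (forall n, measurable_fun setT (F n)) -> (forall n x, `|F n x| <= C) ->
  (forall x, F n x @[n --> \oo] --> f x) ->
  \int[m]_x F n x @[n --> \oo] --> \int[m]_x f x.
Proof.
move=> mF FC Ff.
have mf : measurable_fun setT f by exact: measurable_fun_cvg mF (fun x _ => Ff x).
have fC x : `|f x| <= C.
  have cn : `|F n x| @[n --> \oo] --> `|f x| by apply: cvg_norm; exact: Ff.
  rewrite -(cvg_lim _ cn)//; apply: limr_le; first by apply/cvg_ex; exists `|f x|.
  exact: nearW.
have mF' n : measurable_fun setT (EFin \o F n) by exact/measurable_EFinP.
have mf' : measurable_fun setT (EFin \o f) by exact/measurable_EFinP.
have iC : m.-integrable setT (cst C%:E).
  by apply: (@bounded_integrable m (cst C) `|C|) => // ; exact: measurable_cst.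
have aeF : {ae m, forall x, setT x -> (EFin \o F n) x @[n --> \oo] --> (EFin \o f) x}.
  by apply/aeW => x _; apply: cvg_EFin; [exact: nearW|exact: Ff].
have aeC : {ae m, forall x n, setT x -> (`|(EFin \o F n) x| <= cst C%:E x)%E}.
  by apply/aeW => x n _; rewrite lee_fin; exact: FC.
have [_ _] := dominated_convergence measurableT mF' mf' aeF iC aeC.
move=> cv; apply: fine_cvg; rewrite fineK; last first.
  by apply: integrable_fin_num => //; exact: bounded_integrable fC.
exact: cv.
Qed.

Lemma observable_cvg (F : nat -> R -> R)
    (f : R -> R) (C : R) :
  (forall n, observable (F n)) -> (forall n x, `|F n x| <= C) ->
  (forall x, F n x @[n --> \oo] --> f x) -> observable f.
Proof.
move=> oF FC Ff; split.
- by apply: measurable_fun_cvg (fun x _ => Ff x) => n; case: (oF n).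
- exists C => x.
  have cn : `|F n x| @[n --> \oo] --> `|f x| by apply: cvg_norm; exact: Ff.
  rewrite -(cvg_lim _ cn)//; apply: limr_le; first by apply/cvg_ex; exists `|f x|.
  exact: nearW.
- apply: (measurable_fun_cvg (h := fun n t => \int[M t]_x F n x)).
    by move=> n; case: (oF n).
  by move=> t _; apply: bounded_convergence FC Ff => n; case: (oF n).
Qed.

End observables.

Lemma cvg_expR (R : realType) (u : nat -> R) (l : R) :
  u n @[n --> \oo] --> l -> expR (u n) @[n --> \oo] --> expR l.
Proof. by move=> ul; exact: (cvg_comp u expR ul (@continuous_expR R l)). Qed.

Lemma cvgy_natmul (R : realType) (h : R) : 0 < h ->
  n%:R * h @[n --> \oo] --> +oo.
Proof.
move=> h0; apply: (cvg_comp (fun n : nat => n%:R) (fun x : R => x * h) cvgr_idn).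
exact: gt0_cvgMly cvg_id.
Qed.

(** * From observable powers to half-lines and Borel sets *)

Section generation.
Context d (T : measurableType d) (R : realType) (M : T -> probability R R).
Local Notation obs := (observable M).

(** The partial sums of the exponential series are polynomials in [f], dominated by [expR C] when
    [C] bounds [|f|]. *)
Lemma observable_expR (f : R -> R) : (forall k, obs (fun x => f x ^+ k)) ->
  obs (fun x => expR (f x)).
Proof.
move=> of_; have [_ [C fC] _] := of_ 1%N.
apply: (@observable_cvg _ _ _ _
  (fun n x => series (exp_coeff (f x)) n) _ (expR C)) => [n|n x|x].
- apply: (eq_observable (f := fun x => \sum_(k <- index_iota 0 n)
    k`!%:R^-1 * f x ^+ k)).
    by move=> x; rewrite /series/=; apply: eq_bigr => i _; rewrite exp_coeffE.
  by apply: observable_sum => k; exact: observableZ.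
- rewrite (le_trans (ler_norm_sum _ _ _))//.
  rewrite (_ : \sum_(_ <- _) _ = series (exp_coeff `|f x|) n); last first.
    by rewrite -normed_series_exp_coeff.
  rewrite (@le_trans _ _ (expR `|f x|))// ?ler_expR; last first.
    by have := fC x; rewrite expr1.
  apply: nondecreasing_cvgn_le; last exact: is_cvg_series_exp_coeff.
  by apply: nondecreasing_series => k _; rewrite exp_coeff_ge0.
- exact: is_cvg_series_exp_coeff.
Qed.

(** Powers of the inner exponential are exponentials of multiples of [f], up to constants, so the
    previous lemma applies twice. *)
Lemma observable_expR_expR (f : R -> R) (a b : R) :
  (forall k, obs (fun x => f x ^+ k)) ->
  obs (fun x => expR (- (expR (a * (f x - b))))).
Proof.
move=> of_.
have oe c : obs (fun x => expR (c * f x)).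
  apply: observable_expR => k.
  apply: eq_observable (observableZ (c ^+ k) (of_ k)) => x.
  by rewrite exprMn.
apply: observable_expR => k.
apply: eq_observable (observableZ ((- expR (- (a * b))) ^+ k) (oe (k%:R * a))).
move=> x; rewrite -mulrA expRM_natl -exprMn mulNr -expRD; congr ((- expR _) ^+ k).
ring.
Qed.

(** Pointwise limit of [exp (- exp (n (y - c)))], whence the value at [y = c]. *)
Definition soft_indic (c y : R) : R :=
  if y < c then 1 else if y == c then expR (- 1) else 0.

Lemma cvg_soft_indic (c y : R) :
  expR (- expR (n%:R * (y - c))) @[n --> \oo] --> soft_indic c y.
Proof.
rewrite /soft_indic; have cN (h : R) : 0 < h ->
    expR (- (n%:R * h)) @[n --> \oo] --> (0 : R).
  move=> h0; apply: (cvg_comp (fun n : nat => n%:R * h) (fun x => expR (- x)));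
    last first.
    exact: cvgr_expR.
  exact: cvgy_natmul.
case: ltgtP => yc.
- rewrite [X in _ --> X](_ : _ = expR (- 0)); last by rewrite oppr0 expR0.
  apply: cvg_expR.
  apply: cvgN; have /cN : 0 < c - y by rewrite subr_gt0.
  by under eq_fun do rewrite -mulrN opprB.
- apply: (cvg_comp (fun n : nat => expR (n%:R * (y - c))) (fun x => expR (- x)));
    last exact: cvgr_expR.
  have yc0 : 0 < y - c by rewrite subr_gt0.
  apply: (ger_cvgy _ (cvgy_natmul yc0)) => //.
  apply: nearW => n; rewrite (le_trans _ (expR_ge1Dx _))//.
  by rewrite ler_wpDl.
- rewrite yc subrr; under eq_fun do rewrite mulr0 expR0.
  exact: cvg_cst.
Qed.

(** The double exponential lies in [0, 1], so the limits in [m] and then in [n] are dominated even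
    when the [F m] have no common bound. *)
Lemma observable_soft_indic (F : nat -> R -> R) (g : R -> R) (c : R) :
  (forall x, F n x @[n --> \oo] --> g x) ->
  (forall n k, obs (fun x => F n x ^+ k)) ->
  obs (fun x => soft_indic c (g x)).
Proof.
move=> Fg oF.
apply: (@observable_cvg _ _ _ _
   (fun n x => expR (- expR (n%:R * (g x - c)))) _ 1) => [n|n x|x].
- apply: (@observable_cvg _ _ _ _
     (fun m x => expR (- expR (n%:R * (F m x - c)))) _ 1) => [m|m x|x].
  + exact: observable_expR_expR.
  + by rewrite ger0_norm ?expR_ge0// -expR0 ler_expR oppr_le0 expR_ge0.
  + apply: cvg_expR.
    apply: cvgN; apply: cvg_expR.
    by apply: cvgMr; apply: cvgB; [exact: Fg|exact: cvg_cst].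
- by rewrite ger0_norm ?expR_ge0// -expR0 ler_expR oppr_le0 expR_ge0.
- exact: cvg_soft_indic.
Qed.

Lemma observable_indic_lt (F : nat -> R -> R) (g : R -> R) (c : R) :
  (forall x, F n x @[n --> \oo] --> g x) ->
  (forall n k, obs (fun x => F n x ^+ k)) ->
  obs \1_(g @^-1` `]-oo, c[).
Proof.
(* Thresholds approaching [c] from below remove the value [exp (- 1)] at the threshold. *)
move=> Fg oF; apply: (@observable_cvg _ _ _ _
   (fun n x => soft_indic (c - n.+1%:R^-1) (g x)) _ 1) => [n|n x|x].
- exact: observable_soft_indic Fg oF.
- rewrite /soft_indic; case: ifPn => _; first by rewrite normr1.
  case: ifPn => _; last by rewrite normr0.
  by rewrite ger0_norm ?expR_ge0// -expR0 ler_expR lerN10.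
- rewrite indicE; have [gc|gc] := ltP (g x) c.
    rewrite mem_set/=; last by rewrite in_itv.
    have gc0 : 0 < c - g x by rewrite subr_gt0.
    apply: cvg_near_cst; have := near_infty_natSinv_lt (PosNum gc0).
    apply: filterS => n /= ngc; rewrite /soft_indic ifT//.
    by rewrite ltrBrDr -ltrBrDl.
  rewrite memNset/=; last by rewrite in_itv/= ltNge gc.
  apply: cvg_near_cst; apply: nearW => n; rewrite /soft_indic.
  have lt : c - n.+1%:R^-1 < g x by rewrite (lt_le_trans _ gc)// gtrBl invr_gt0.
  by rewrite ltNge (ltW lt)/= gt_eqF.
Qed.

(** Half-lines are stable under intersection and generate the Borel sets, and the good sets [B] form
    a Dynkin class. *)
Theorem measurable_eval_preimage (F : nat -> R -> R) (g : R -> R) :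
  (forall x, F n x @[n --> \oo] --> g x) ->
  (forall n k, obs (fun x => F n x ^+ k)) ->
  forall B, measurable B -> measurable_fun setT (fun t => M t (g @^-1` B)).
Proof.
move=> Fg oF.
have mg : measurable_fun setT g.
  apply: measurable_fun_cvg (fun x _ => Fg x) => n; have [] := oF n 1%N.
  by under eq_fun do rewrite expr1.
have mgB B : measurable B -> measurable (g @^-1` B).
  by move=> mB; rewrite -[X in measurable X]setTI; exact: mg.
have mE : @measurable _ R = <<s @RGenInftyO.G R >>.
  exact: RGenInftyO.measurableE.
move=> B; rewrite [X in X _ -> _]mE; move: B.
apply: (dynkin_induction (G := @RGenInftyO.G R)) => //.
- move=> _ _ [x ->] [y ->]; exists (Num.min x y); apply/seteqP; split => z /=;
    rewrite !in_itv/= lt_min; by move=> /andP.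
- rewrite preimage_setT (_ : (fun _ => _) = cst 1%E)//.
  by apply/funext => t; rewrite probability_setT.
- move=> _ [c ->]; have [m1 _ mI] := observable_indic_lt c Fg oF.
  rewrite (_ : (fun _ => _) =
      (fun t => (\int[M t]_x (\1_(g @^-1` `]-oo, c[) x))%:E)).
    exact/measurable_EFinP.
  apply/funext => t; rewrite /Rintegral fineK; last first.
    by apply: integrable_fin_num => //; apply: integrable_indic; exact: mgB.
  by rewrite integral_indic ?setIT//; exact: mgB.
- move=> S mS IH.
  rewrite preimage_setC (_ : (fun _ => _) = (fun t => 1 - M t (g @^-1` S))%E).
    exact: emeasurable_funB.
  by apply/funext => t; rewrite probability_setC//; exact: mgB.
- move=> G mG tG IH.
  rewrite (_ : (fun _ => _) =
      (fun t => \sum_(0 <= i <oo) M t (g @^-1` (G i)))%E).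
    exact: ge0_emeasurable_sum.
  apply/funext => t; rewrite preimage_bigcup measure_bigcup//.
  + by apply: eq_eseriesl => i; rewrite in_setT.
  + by move=> i _; apply: mgB; exact: mG.
  + apply/trivIsetP => i j _ _ ij; rewrite -preimage_setI.
    by move/trivIsetP : tG => ->//; rewrite preimage_set0.
Qed.

End generation.

(** * From transforms to laws of random measures *)

Section product_space.
Context (I : Type) d (E : measurableType d).

Lemma measurable_to_product d' (T : measurableType d')
    (f : T -> product_space I E) :
  (forall i, measurable_fun setT (fun t => f t i)) -> measurable_fun setT f.
Proof.
move=> mf; apply: (@measurability _ _ T (product_space I E) setT f
  (@cylinders I d E)) => // _ [_ [i [B [mB ->]]] <-].
exact: mf.
Qed.

Lemma measurable_coordinate (i : I) :
  measurable_fun setT (fun x : product_space I E => x i).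
Proof.
by move=> _ B mB; rewrite setTI; apply: sub_sigma_algebra; exists i, B.
Qed.

End product_space.

Lemma measurable_to_pprobability (R : realType) d (T : measurableType d)
    d' (E : measurableType d') (M : T -> pprobability E R) :
  (forall B, measurable B -> measurable_fun setT (fun t => M t B)) ->
  measurable_fun setT M.
Proof.
move=> mM; apply: (measurability (@pset _ _ _ : set (set (pprobability E R)))) => //.
move=> _ [_ [r _ [B mB <-]] <-].
rewrite setTI (_ : M @^-1` mset B r = (fun t => M t B) @^-1` `]-oo, r%:E[).
  by rewrite -[X in measurable X]setTI; apply: mM => //; exact: emeasurable_itv.
by apply/seteqP; split => t /=; rewrite in_itv.
Qed.

(* The sigma-algebra on the space of measures which makes the transform
   measurable only sees measures in [D]: outside [D] a measure is replaced by
   a fixed element of [D]. *)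
Lemma measurable_trace (R : realType) (I : Type) d (E : measurableType d)
    (X : I -> pprobability R R -> E) (D : set (probability R R))
    (A : set (pprobability R R)) :
  (forall d' (T : measurableType d') (M : T -> probability R R),
    (forall t, D (M t)) ->
    (forall i, measurable_fun setT (fun t => X i (M t))) ->
    forall B, measurable B -> measurable_fun setT (fun t => M t B)) ->
  D !=set0 -> measurable A ->
  exists2 V : set (product_space I E), measurable V &
    forall m, D m -> A m <-> V (fun i => X i m).
Proof.
move=> eval [m0 Dm0] mA.
pose M (m : pprobability R R) : probability R R :=
  if pselect (D m) then m else m0.
have DM m : D (M m) by rewrite /M; case: pselect.
pose f m : product_space I E := fun i => X i (M m).
(* The space of measures itself serves as parameter space, with the sigma-algebra generated by the
   transform: its measurable sets are the [f]-preimages of measurable sets. *)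
pose T : measurableType _ := g_sigma_algebra_preimageType f.
have mf : measurable_fun setT (f : T -> _).
  by move=> _ B mB; exists B.
have mM : measurable_fun setT (M : T -> pprobability R R).
  apply: measurable_to_pprobability; apply: eval => // i.
  exact: (measurableT_comp (measurable_coordinate (E := E) i) mf).
have [V mV fV] := mM measurableT A mA; exists V => // m Dm.
have MmE : M m = m by rewrite /M; case: pselect.
have : (setT `&` f @^-1` V) m = (setT `&` M @^-1` A) m by rewrite fV.
rewrite !setTI /= MmE /f/= MmE.
by move=> ->.
Qed.

(** Supplies the fixed element of [D] for [measurable_trace]: an empty class would make the whole
    space negligible. *)
Lemma ae_nonempty (R : realType) d (Omega : measurableType d)
    (P : probability Omega R) (mu : Omega -> probability R R)
    (D : set (probability R R)) :
  {ae P, forall w, D (mu w)} -> D !=set0.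
Proof.
move=> aeD; apply/set0P/eqP => D0; move: aeD; rewrite D0 => -[N [mN N0 sN]].
have : P setT = 0%E.
  by apply/eqP; rewrite -measure_le0 -N0 le_measure ?inE// => w _; exact: sN.
by rewrite probability_setT => /eqP; rewrite onee_eq0.
Qed.

Lemma ae_eq_measure d (T : measurableType d) (R : realType)
    (m : {measure set T -> \bar R}) (A B : set T) :
  measurable A -> measurable B -> {ae m, forall w, A w <-> B w} -> m A = m B.
Proof.
move=> mA mB [N [mN N0 sN]].
have key C D : measurable C -> measurable D ->
    (forall w, ~ N w -> C w -> D w) -> (m C <= m D)%E.
  move=> mC mD CD; rewrite -[leRHS]adde0 -N0.
  apply: le_trans (measureU2 _ mD mN); apply: le_measure; rewrite ?inE//.
    exact: measurableU.
  by move=> w Cw; have [Nw|/CD/(_ Cw)] := pselect (N w); [right|left].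
have ABN w : ~ N w -> (A w <-> B w) by move=> nNw; apply: contra_notP nNw; exact: sN.
by apply/eqP; rewrite eq_le !key// => w /ABN[].
Qed.

(** Up to null sets, the measure lies in [A] exactly when its transform lies in the set [V] of
    [measurable_trace], and the law of the transform decides the probability of the latter. *)
Lemma eq_distribution_transform (R : realType) d1 d2
    (Omega1 : measurableType d1) (Omega2 : measurableType d2)
    (P : probability Omega1 R) (Q : probability Omega2 R)
    (mu : {RV P >-> pprobability R R}) (nu : {RV Q >-> pprobability R R})
    (I : Type) d (E : measurableType d)
    (X : I -> pprobability R R -> E) (D : set (probability R R)) :
  (forall i, measurable_fun setT (X i)) ->
  (forall d' (T : measurableType d') (M : T -> probability R R),
    (forall t, D (M t)) ->
    (forall i, measurable_fun setT (fun t => X i (M t))) ->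
    forall B, measurable B -> measurable_fun setT (fun t => M t B)) ->
  {ae P, forall w, D (mu w)} -> {ae Q, forall w, D (nu w)} ->
  eq_joint_distribution P Q (fun i w => X i (mu w)) (fun i w => X i (nu w)) ->
  eq_distribution P Q mu nu.
Proof.
move=> mX eval aeP aeQ eqXY A mA.
have [V mV DAV] := measurable_trace eval (ae_nonempty aeP) mA.
have mXmu : measurable_fun setT (fun w => (fun i => X i (mu w)) : product_space I E).
  by apply: measurable_to_product => i; exact: measurableT_comp.
have mXnu : measurable_fun setT (fun w => (fun i => X i (nu w)) : product_space I E).
  by apply: measurable_to_product => i; exact: measurableT_comp.
transitivity (P (mu @^-1` A)) => //.
transitivity (Q (nu @^-1` A)) => //.
rewrite (@ae_eq_measure _ _ _ P _ ((fun w => (fun i => X i (mu w))) @^-1` V)).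
- rewrite (@ae_eq_measure _ _ _ Q _ ((fun w => (fun i => X i (nu w))) @^-1` V)).
  + exact: eqXY.
  + by rewrite -[X in measurable X]setTI; exact: measurable_funP.
  + by rewrite -[X in measurable X]setTI; exact: mXnu.
  + by apply: filterS aeQ => w; exact: DAV.
- by rewrite -[X in measurable X]setTI; exact: measurable_funP.
- by rewrite -[X in measurable X]setTI; exact: mXmu.
- by apply: filterS aeP => w; exact: DAV.
Qed.

(** * Measurability of the transforms *)

Section measurable_transforms.
Context (R : realType).
Local Open Scope complex_scope.

Lemma measurable_eval (B : set R) : measurable B ->
  measurable_fun setT (fun m : pprobability R R => m B).
Proof.
exact: (measurable_kernel (kprobability (@measurable_id _ (pprobability R R) setT))).
Qed.

Lemma measurable_integral (D : set R) (f : R -> \bar R) :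
  measurable D -> measurable_fun D f ->
  measurable_fun setT
    (fun m : pprobability R R => (\int[m : probability R R]_(x in D) f x)%E).
Proof.
move=> mD mf; under eq_fun do rewrite integral_mkcond integralE.
have mfD : measurable_fun setT (f \_ D) by apply/(measurable_restrictT _ mD).
by apply: emeasurable_funB; apply: measurable_fun_integral_kernel => //;
  [exact: measurable_eval|exact: measurable_funepos|
   exact: measurable_eval|exact: measurable_funeneg].
Qed.

Lemma measurable_Rintegral (D : set R) (f : R -> R) :
  measurable D -> measurable_fun D f ->
  measurable_fun setT
    (fun m : pprobability R R => \int[m : probability R R]_(x in D) f x).
Proof.
move=> mD mf; apply: measurableT_comp => //.
by apply: measurable_integral => //; exact/measurable_EFinP.
Qed.

(** An open set of the plane is the union of the countably many rational boxes it contains. *)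
Lemma measurable_to_borelC d (T : measurableType d) (a b : T -> R) :
  measurable_fun setT a -> measurable_fun setT b ->
  measurable_fun setT (fun t => a t +i* b t : borelC R).
Proof.
move=> ma mb.
pose G := @open (R[i] : numFieldType).
apply: (@measurability _ _ T (borelC R) setT _ G) => //.
move=> _ [U oU <-]; rewrite setTI.
pose box (q : (rat * rat) * (rat * rat)) (x y : R) :=
  ratr q.1.1 < x < ratr q.1.2 /\ ratr q.2.1 < y < ratr q.2.2.
pose F q := [set t | box q (a t) (b t) /\ forall x y, box q x y -> U (x +i* y)].
rewrite (_ : _ @^-1` _ = \bigcup_q F q); last first.
  apply/seteqP; split => [t /= Ut|t [q _ [qt]]]; last exact.
  have [e e0 eU] : exists2 e : R, 0 < e & forall x y,
      `|a t - x| < e -> `|b t - y| < e -> U (x +i* y).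
    move: oU; rewrite /G openE => /(_ _ Ut) /nbhs_ballP [z z0 zU].
    (* Positivity in the order of [R[i]] forces the radius [z] to be real. *)
    have [zr zi] : 0 < complex.Re z /\ complex.Im z = 0.
      by move: z0; rewrite /= ltcE/= => /andP[/eqP -> ->].
    exists (complex.Re z / 2) => [|x y ax bY]; first by rewrite divr_gt0.
    apply: zU; rewrite -ball_normE/= /ball_/=.
    rewrite normc_def ltcE/= zi eqxx/=.
    rewrite (@le_lt_trans _ _ (`|a t - x| + `|b t - y|))//; last first.
      by rewrite [ltRHS]splitr ltrD.
    rewrite -[leRHS]ger0_norm ?addr_ge0// -sqrtr_sqr ler_wsqrtr//.
    rewrite [leRHS]sqrrD !real_normK ?num_real// -addrA lerD2l lerDr.
    by rewrite mulrn_wge0// mulr_ge0.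
  have ratlt (c : R) : exists p : rat * rat,
      ratr p.1 < c < ratr p.2 /\ forall x, ratr p.1 < x < ratr p.2 -> `|c - x| < e.
    have [p1] := rat_in_itvoo (ltac:(by rewrite gtrBl) : c - e < c).
    have [p2] := rat_in_itvoo (ltac:(by rewrite ltrDl) : c < c + e).
    rewrite !in_itv/= => /andP[cp2 p2e] /andP[ep1 p1c].
    exists (p1, p2); split => [|x /andP[p1x xp2]]; first by rewrite p1c.
    by rewrite ltr_distlC; apply/andP; split; lra.
  have [[p [ap pe]] [q [bq qe]]] := (ratlt (a t), ratlt (b t)).
  by exists (p, q) => //; split => // x y [/pe ax /qe bY]; exact: eU.
apply: countable_bigcupT_measurable => // q.
have [qU|nqU] := pselect (forall x y, box q x y -> U (x +i* y)); last first.
  by rewrite (_ : F q = set0)//; apply/seteqP; split => // t [_ /nqU].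
rewrite (_ : F q = a @^-1` `]ratr q.1.1, ratr q.1.2[ `&`
                   b @^-1` `]ratr q.2.1, ratr q.2.2[).
  by apply: measurableI; rewrite -[X in measurable X]setTI;
    [exact: ma|exact: mb].
by apply/seteqP; split => t; rewrite /F/box/= !in_itv/= => -[]; tauto.
Qed.

Let normc_ge_Im (z : R[i]) : `|complex.Im z|%:C <= `|z|.
Proof.
rewrite normc_def lecR -sqrtr_sqr ler_wsqrtr// lerDr sqr_ge0//.
Qed.

Lemma measurable_Re : measurable_fun setT (fun z : borelC R => complex.Re z).
Proof.
apply: (measurability _ (RGenInftyO.measurableE R)) => // _ [_ [x ->] <-].
rewrite setTI; apply: sub_sigma_algebra => /=; rewrite openE => z /=.
rewrite in_itv/= => zx; apply/nbhs_ballP; exists (x - complex.Re z)%:C => /=.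
  by rewrite ltcR subr_gt0.
move=> w; rewrite -ball_normE/= in_itv/= => zw.
have := le_lt_trans (normc_ge_Re _) zw; rewrite ltcR/=.
by rewrite raddfB ltr_distl => /andP[]; lra.
Qed.

Lemma measurable_Im : measurable_fun setT (fun z : borelC R => complex.Im z).
Proof.
apply: (measurability _ (RGenInftyO.measurableE R)) => // _ [_ [x ->] <-].
rewrite setTI; apply: sub_sigma_algebra => /=; rewrite openE => z /=.
rewrite in_itv/= => zx; apply/nbhs_ballP; exists (x - complex.Im z)%:C => /=.
  by rewrite ltcR subr_gt0.
move=> w; rewrite -ball_normE/= in_itv/= => zw.
have := le_lt_trans (normc_ge_Im _) zw; rewrite ltcR/=.
by rewrite raddfB ltr_distl => /andP[]; lra.
Qed.

End measurable_transforms.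

(** * Characteristic functions and Laplace transforms *)

(** Serves with the sine, with [- exp (- y)] and with the exponential, each of derivative 1 at 0. *)
Lemma cvg_difference_quotient (R : realType) (f : R -> R) (c x : R) :
  is_derive (0 : R) (1 : R) f c ->
  n.+1%:R * (f (n.+1%:R^-1 * x) - f 0) @[n --> \oo] --> c * x.
Proof.
move=> fc; pose g h := f (x * h).
have [dg gE] : is_derive (0 : R) (1 : R) g (c * x).
  apply: (@is_derive1_comp _ f (fun h => x * h)); first by rewrite mulr0.
  have := is_deriveZ x (is_derive_id (0 : R) (1 : R)).
  by rewrite /GRing.scale/= mulr1.
have : h^-1 *: (g (h *: 1 + 0) - g 0) @[h --> (0 : R)^'] --> c * x.
  by rewrite -gE; exact: dg.
move=> /cvgr_dnbhsP /(_ (fun n => n.+1%:R^-1)).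
rewrite /g mulr0 => cg.
under eq_fun => n.
  rewrite (_ : _ * _ = n.+1%:R^-1^-1 *: (f (x * (n.+1%:R^-1 *: 1 + 0)) - f 0)).
    over.
  by rewrite invrK addr0 /GRing.scale/= mulr1 (mulrC x).
by apply: cg; split => [n|]; [rewrite invr_neq0|exact: cvg_harmonic].
Qed.

Section char_fun.
Context d (T : measurableType d) (R : realType) (M : T -> probability R R).
Hypothesis mM : forall s, measurable_fun setT (fun t => char_fun (M t) s).
Local Notation obs := (observable M).

Lemma observable_cos s : obs (fun x => cos (s * x)).
Proof.
split.
- by apply: continuous_measurable_fun => x; apply: continuous_comp;
    [exact: mulrl_continuous|exact: continuous_cos].
- by exists 1 => x; exact: cos_max.
- exact: (measurableT_comp (@measurable_Re R) (mM s)).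
Qed.

Lemma observable_sin s : obs (fun x => sin (s * x)).
Proof.
split.
- by apply: continuous_measurable_fun => x; apply: continuous_comp;
    [exact: mulrl_continuous|exact: continuous_sin].
- by exists 1 => x; exact: sin_max.
- exact: (measurableT_comp (@measurable_Im R) (mM s)).
Qed.

Lemma observable_sinX s k : obs (fun x => sin (s * x) ^+ k).
Proof.
(* Carrying a factor [cos (u x)] or [sin (u x)] for all [u] closes the induction: by the product
   formulas, one more [sin (s x)] only shifts [u] by [s] or [- s]. *)
suff K (u : R) : obs (fun x => sin (s * x) ^+ k * cos (u * x)) /\
                 obs (fun x => sin (s * x) ^+ k * sin (u * x)).
  by have [+ _] := K 0; apply: eq_observable => x; rewrite mul0r cos0 mulr1.
elim: k u => [u|k IHk u].
  by split; [apply: eq_observable (observable_cos u)|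
             apply: eq_observable (observable_sin u)] => x; rewrite mul1r.
have [[c1 s1] [c2 s2]] := (IHk (u + s), IHk (u - s)).
split.
- apply: eq_observable (observableZ 2^-1 (observableB s1 s2)) => x.
  by rewrite exprSr mulrDl mulrBl sinD sinB; field.
- apply: eq_observable (observableZ 2^-1 (observableB c2 c1)) => x.
  by rewrite exprSr mulrBl mulrDl cosB cosD; field.
Qed.

Theorem measurable_eval_char_fun B : measurable B ->
  measurable_fun setT (fun t => M t B).
Proof.
apply: (measurable_eval_preimage (F := fun n x => n.+1%:R * sin (n.+1%:R^-1 * x))
  (g := idfun)) => [x|n k].
  have := @cvg_difference_quotient R sin _ x (is_derive_sin (0 : R)).
  by rewrite cos0 mul1r sin0; under eq_fun do rewrite subr0.
apply: eq_observable (observableZ (n.+1%:R ^+ k) (observable_sinX n.+1%:R^-1 k)) => x.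
by rewrite exprMn.
Qed.

End char_fun.

Section laplace.
Context d (T : measurableType d) (R : realType) (M : T -> probability R R).
Hypothesis mM : forall s, measurable_fun setT (fun t => laplace (M t) s).
Hypothesis M_ge0 : forall t, supported_nonneg (M t).
Local Notation obs := (observable M).

Lemma ae_supported_nonneg t : {ae M t, forall x : R, 0 <= x}.
Proof.
exists `]-oo, 0[%classic; split => //.
- have -> : `]-oo, (0 : R)[%classic = ~` `[0, +oo[%classic.
    by apply/seteqP; split => x /=; rewrite !in_itv/= andbT ltNge => /negP.
  by rewrite probability_setC// M_ge0 subee.
- by move=> x /= /negP; rewrite in_itv/= -ltNge.
Qed.

Let measurable_expN (s : R) :
  measurable_fun setT (fun x : R => expR (- (s * Num.max x 0))).
Proof.
apply: measurableT_comp => //; apply: measurableT_comp => //.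
by apply: measurable_funM => //; exact: measurable_maxr.
Qed.

(** Observables are bounded on the whole line, hence the truncation [Num.max x 0]; it changes
    nothing almost everywhere for measures on the half-line. *)
Lemma observable_expRN (s : {nonneg R}) :
  obs (fun x => expR (- (s%:num * Num.max x 0))).
Proof.
split.
- exact: measurable_expN.
- exists 1 => x; rewrite ger0_norm ?expR_ge0// -expR0 ler_expR oppr_le0.
  by rewrite mulr_ge0// le_max lexx orbT.
- rewrite (_ : (fun t => _) = (fun t => laplace (M t) s)); first exact: mM.
  apply/funext => t; rewrite /laplace [RHS]Rintegral_mkcond /Rintegral; congr fine.
  apply: ae_eq_integral => //.
  + by apply/measurable_EFinP; exact: measurable_expN.
  + apply/measurable_EFinP.
    apply/(measurable_restrictT (D := `[(0 : R), +oo[%classic)) => //.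
    by apply: measurableT_comp => //; apply: measurableT_comp => //;
      exact: measurable_funM.
  + apply: filterS (ae_supported_nonneg t) => x x0 _.
    by rewrite /restrict/= mem_set/= ?in_itv/= ?x0// max_l.
Qed.

Lemma observable_1BexpRNX (s : {nonneg R}) k :
  obs (fun x => (1 - expR (- (s%:num * Num.max x 0))) ^+ k).
Proof.
(* Multiplying by [1 - exp (- s x)] turns the exponential of rate [u] into the difference of those
   of rates [u] and [u + s]. *)
suff K (u : {nonneg R}) : obs (fun x =>
    (1 - expR (- (s%:num * Num.max x 0))) ^+ k * expR (- (u%:num * Num.max x 0))).
  have := K (NngNum (lexx 0)); apply: eq_observable => x.
  by rewrite mul0r oppr0 expR0 mulr1.
elim: k u => [u|k IHk u].
  by apply: eq_observable (observable_expRN u) => x; rewrite mul1r.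
have us0 : 0 <= u%:num + s%:num by rewrite addr_ge0.
apply: eq_observable (observableB (IHk u) (IHk (NngNum us0))) => x /=.
by rewrite exprSr mulrDl opprD expRD; ring.
Qed.

Theorem measurable_eval_laplace B : measurable B ->
  measurable_fun setT (fun t => M t B).
Proof.
move=> mB.
(* The approximations converge to the positive part, so [B] is traded for its preimage under it, of
   the same mass. *)
rewrite (_ : (fun t => _) = (fun t => M t ((Num.max^~ (0 : R)) @^-1` B))).
  move: B mB; apply: (measurable_eval_preimage
    (F := fun n x => n.+1%:R * (1 - expR (- (n.+1%:R^-1 * Num.max x 0)))))
    => [x|n k].
    have de : is_derive (0 : R) (1 : R) (fun y => - expR (- y)) 1.
      have dN := is_deriveN (is_derive_id (0 : R) (1 : R)).
      have := is_deriveN (is_derive1_comp (is_derive_expR (- (0 : R))) dN).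
      by rewrite oppr0 expR0 mulrN1 opprK.
    have := @cvg_difference_quotient R _ _ (Num.max x 0) de.
    by rewrite mul1r oppr0 expR0; under eq_fun do rewrite opprK addrC.
  have n0 : 0 <= n.+1%:R^-1 :> R by [].
  apply: eq_observable (observableZ (n.+1%:R ^+ k)
    (observable_1BexpRNX (NngNum n0) k)) => x.
  by rewrite exprMn.
apply/funext => t; apply: ae_eq_measure => //.
  by rewrite -[X in measurable X]setTI; exact: measurable_maxr.
by apply: filterS (ae_supported_nonneg t) => x x0; rewrite /= max_l.
Qed.

End laplace.

(** * Orthogonal polynomials *)

Section orthogonal_polynomials.
Context (R : realType) (L : {poly R} -> R).
Hypothesis L_linear : forall c (p q : {poly R}), L (c *: p + q) = c * L p + L q.
Hypothesis L_ge0 : forall p : {poly R}, 0 <= L (p * p).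
Hypothesis L1 : L 1 = 1.

Let LD p q : L (p + q) = L p + L q.
Proof. by rewrite -[p in LHS]scale1r L_linear mul1r. Qed.

Let L0 : L 0 = 0.
Proof. by apply: (addrI (L 0)); rewrite -LD !addr0. Qed.

Let LZ c p : L (c *: p) = c * L p.
Proof. by rewrite -[c *: p]addr0 L_linear L0 addr0. Qed.

Let LN p : L (- p) = - L p.
Proof. by rewrite -scaleN1r LZ mulN1r. Qed.

Let L_sum (I : Type) (s : seq I) (F : I -> {poly R}) :
  L (\sum_(i <- s) F i) = \sum_(i <- s) L (F i).
Proof. by elim: s => [|i s IH]; rewrite ?big_nil ?big_cons// LD IH. Qed.

(* [orthopair n] is the pair of the monic orthogonal polynomials of degrees
   [n - 1] and [n], by the three-term recurrence; for [n = 0] the first one is 0,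
   so that the division by its norm is immaterial. *)
Fixpoint orthopair (n : nat) : {poly R} * {poly R} :=
  if n is k.+1 then
    let: (q, p) := orthopair k in
    (p, 'X * p - (L ('X * (p * p)) / L (p * p)) *: p
        - (L (p * p) / L (q * q)) *: q)
  else (0, 1).

Definition ortho n := (orthopair n).2.
Definition ortho_prev n := (orthopair n).1.
Definition sqnorm n := L (ortho n * ortho n).
Local Notation alpha n := (L ('X * (ortho n * ortho n)) / sqnorm n).
Local Notation beta n := (sqnorm n / L (ortho_prev n * ortho_prev n)).

Lemma orthoS n :
  ortho n.+1 = 'X * ortho n - alpha n *: ortho n - beta n *: ortho_prev n.
Proof. by rewrite /ortho/= /sqnorm /ortho /ortho_prev; case: (orthopair n). Qed.

Lemma ortho_prevS n : ortho_prev n.+1 = ortho n.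
Proof. by rewrite /ortho /ortho_prev/=; case: (orthopair n). Qed.

Lemma sqnorm0 : sqnorm 0 = 1. Proof. by rewrite /sqnorm/= mulr1. Qed.

Lemma sqnorm_ge0 n : 0 <= sqnorm n. Proof. exact: L_ge0. Qed.

(** In the step to [n + 1], [alpha] cancels the case [i = n] and [beta] the case [i = n - 1]; for
    smaller [i], [X p_i] is a combination of polynomials orthogonal to [p_n]. *)
Lemma orthogonal n i j : (forall k, (k < n)%N -> sqnorm k != 0) ->
  (i < j <= n)%N -> L (ortho j * ortho i) = 0.
Proof.
elim: n i j => [|n IHn] i j hn; first by case: j => // j /andP[].
have {}IHn i' j' : (i' < j' <= n)%N -> L (ortho j' * ortho i') = 0.
  by apply: IHn => k kn; apply: hn; exact: ltnW.
have prev0 i' : (i' <= n)%N -> L (ortho n * ortho_prev i') = 0.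
  case: i' => [_|k kn]; first by rewrite mulr0.
  by rewrite ortho_prevS; apply: IHn; rewrite kn/=.
move=> /andP[ij]; rewrite leq_eqVlt => /predU1P[jn|]; last first.
  by rewrite ltnS => jn; apply: IHn; rewrite ij.
rewrite {}jn ltnS in ij *.
rewrite orthoS !mulrBl !LD !LN -!scalerAl !LZ.
move: ij; rewrite leq_eqVlt => /predU1P[->|ij].
  rewrite -mulrA -/(sqnorm n) divfK ?hn// subrr sub0r.
  by rewrite (mulrC (ortho_prev n) (ortho n)) prev0// mulr0 oppr0.
rewrite (IHn i n) ?ij ?leqnn// mulr0 subr0.
have -> : 'X * ortho n * ortho i = ortho n * ('X * ortho i) by ring.
have -> : 'X * ortho i = ortho i.+1 + alpha i *: ortho i + beta i *: ortho_prev i.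
  by rewrite orthoS; ring.
rewrite !mulrDr !LD -!scalerAr !LZ (IHn i n) ?ij ?leqnn// mulr0 addr0.
rewrite prev0 ?mulr0 ?addr0; last exact: ltnW.
case: n ij hn IHn prev0 => // n; rewrite ltnS leq_eqVlt ortho_prevS.
move=> /predU1P[->|ij] hn IHn prev0.
  by rewrite -!/(sqnorm _) divfK ?subrr// hn.
by rewrite (IHn i.+1 n.+1) ?ltnS ?ij ?leqnn// (IHn i n) ?ij ?leqnSn// mulr0 subr0.
Qed.

Lemma size_orthoBX n : (size (ortho n - 'X^n)%R <= n)%N.
Proof.
suff: (size (ortho n - 'X^n)%R <= n)%N && (size (ortho_prev n) <= n)%N.
  by move=> /andP[].
elim: n => [|n /andP[IHn IHp]]; first by rewrite subrr size_poly0.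
have son : (size (ortho n) <= n.+1)%N.
  rewrite -[ortho n](subrK 'X^n) (leq_trans (size_polyD _ _))// size_polyXn.
  by rewrite geq_max ltnSn andbT ltnW.
rewrite ortho_prevS son andbT orthoS exprS.
rewrite (_ : _ - _ = 'X * (ortho n - 'X^n) - alpha n *: ortho n
    - beta n *: ortho_prev n); last by ring.
rewrite (leq_trans (size_polyD _ _))// geq_max size_polyN.
rewrite (leq_trans (size_scale_leq _ _)) ?(leq_trans IHp)// andbT.
rewrite (leq_trans (size_polyD _ _))// geq_max size_polyN.
rewrite (leq_trans (size_scale_leq _ _))// andbT.
have [->|x0] := eqVneq (ortho n - 'X^n) 0; first by rewrite mulr0 size_poly0.
by rewrite mulrC size_mulX.
Qed.

(** Subtracting from [q] its coefficient at [m] times the monic [ortho m] lowers the size. *)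
Lemma orthogonal_lower m (r : {poly R}) :
  (forall i, (i < m)%N -> L (r * ortho i) = 0) ->
  forall q : {poly R}, (size q <= m)%N -> L (r * q) = 0.
Proof.
elim: m => [_ q|m IHm rm q qm].
  by rewrite leqn0 size_poly_eq0 => /eqP ->; rewrite mulr0.
have om : ortho m = 'X^m + (ortho m - 'X^m) by rewrite addrC subrK.
rewrite -[q](subrK (q`_m *: ortho m)) mulrDr LD -scalerAr LZ rm// mulr0 addr0.
apply: IHm => [i im|]; first by rewrite rm// ltnW.
apply/leq_sizeP => j mj; rewrite coefB coefZ om coefD coefXn.
rewrite [(ortho m - _)`_j]nth_default ?(leq_trans (size_orthoBX m))// addr0.
move: mj; rewrite leq_eqVlt => /predU1P[<-|mj]; first by rewrite eqxx mulr1 subrr.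
by rewrite gtn_eqF// mulr0 subr0 nth_default// (leq_trans qm).
Qed.

(** Pythagoras: [X^n - ortho n] has lower degree, hence is orthogonal to [ortho n]. *)
Lemma sqnorm_le n : (forall k, (k < n)%N -> sqnorm k != 0) ->
  sqnorm n <= L 'X^(2 * n).
Proof.
move=> hn; have oX : L (ortho n * ('X^n - ortho n)) = 0.
  apply: (@orthogonal_lower n) => [i ni|].
    by rewrite (@orthogonal n)// ni/=.
  by rewrite -opprB size_polyN size_orthoBX.
have := L_ge0 ('X^n - ortho n); rewrite {1}mulrBl LD LN oX subr0.
rewrite mulrBr LD LN -exprD addnn -mul2n.
rewrite (_ : 'X^n * ortho n = ortho n * ('X^n - ortho n) + ortho n * ortho n);
  last by ring.
by rewrite LD oX add0r subr_ge0.
Qed.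

(** * Values at the point ib and the Christoffel-Darboux kernel *)

Variable b : R.
Hypothesis b_gt0 : 0 < b.

Definition ev (p : {poly R}) : R[i] :=
  (map_poly (real_complex R) p).[Complex 0 b].
Definition evRe p := complex.Re (ev p).
Definition evIm p := complex.Im (ev p).
Local Notation A n := (evRe (ortho n)).
Local Notation B n := (evIm (ortho n)).

Lemma evReD p q : evRe (p + q) = evRe p + evRe q.
Proof. by rewrite /evRe /ev rmorphD hornerD raddfD. Qed.

Lemma evImD p q : evIm (p + q) = evIm p + evIm q.
Proof. by rewrite /evIm /ev rmorphD hornerD raddfD. Qed.

Lemma evReZ c p : evRe (c *: p) = c * evRe p.
Proof.
rewrite /evRe /ev -mul_polyC rmorphM hornerM /= map_polyC hornerC.
by case: (_.[_]) => x y /=; rewrite mul0r subr0.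
Qed.

Lemma evImZ c p : evIm (c *: p) = c * evIm p.
Proof.
rewrite /evIm /ev -mul_polyC rmorphM hornerM /= map_polyC hornerC.
by case: (_.[_]) => x y /=; rewrite mul0r addr0.
Qed.

Lemma evReN p : evRe (- p) = - evRe p.
Proof. by rewrite -scaleN1r evReZ mulN1r. Qed.

Lemma evImN p : evIm (- p) = - evIm p.
Proof. by rewrite -scaleN1r evImZ mulN1r. Qed.

Lemma evReMX p : evRe ('X * p) = - (b * evIm p).
Proof.
rewrite /evRe /evIm /ev rmorphM hornerM /= map_polyX hornerX.
by case: (_.[_]) => x y /=; rewrite mul0r sub0r.
Qed.

Lemma evImMX p : evIm ('X * p) = b * evRe p.
Proof.
rewrite /evRe /evIm /ev rmorphM hornerM /= map_polyX hornerX.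
by case: (_.[_]) => x y /=; rewrite mul0r add0r.
Qed.

Lemma evReC c : evRe c%:P = c.
Proof. by rewrite /evRe /ev /= map_polyC hornerC. Qed.

Lemma evImC c : evIm c%:P = 0.
Proof. by rewrite /evIm /ev /= map_polyC hornerC. Qed.

(* Real and imaginary parts of [p = p(ib) + (X - ib) (u + iv)]. *)
Lemma div_evP p : exists u v : {poly R},
  p = (evRe p)%:P + 'X * u + b *: v /\ b *: u = (evIm p)%:P + 'X * v.
Proof.
elim/poly_ind: p => [|p c [u [v [pE uE]]]].
  by exists 0, 0; rewrite /evRe /evIm /ev rmorph0 horner0 !mulr0 !scaler0 !addr0.
exists ((evRe p)%:P + 'X * u), ((evIm p)%:P + 'X * v).
rewrite (mulrC p) evReD evImD evReMX evImMX evReC evImC addr0.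
move: pE uE; set x := evRe p; set y := evIm p; rewrite -!mul_polyC => -> uE.
rewrite polyCD polyCN !polyCM; split; first by ring.
by rewrite mulrDr (mulrCA _ 'X) uE.
Qed.

(** The hypotheses say that [P + iQ] takes the value 1 at [ib], hence is of the form
    [1 - (X - ib) (u + iv)]. *)
Lemma approx_of_ev (P Q : {poly R}) :
  evRe P - evIm Q = 1 -> evIm P + evRe Q = 0 ->
  exists u v : {poly R}, 1 - 'X * u - b *: v = P /\ b *: u - 'X * v = Q.
Proof.
move=> e1 e0; have [u1 [v1 [PE uE1]]] := div_evP P.
have [u2 [v2 [QE uE2]]] := div_evP Q.
exists (v2 - u1), (- (v1 + u2)).
have e1' : (evRe P)%:P = 1 + (evIm Q)%:P :> {poly R}.
  by rewrite -polyC1 -e1 -polyCD subrK.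
have e0' : (evRe Q)%:P = - (evIm P)%:P :> {poly R}.
  by rewrite -polyCN; congr _%:P; apply/eqP; rewrite -addr_eq0 addrC e0.
rewrite e1' in PE; rewrite e0' in QE; rewrite -!mul_polyC in PE uE1 QE uE2 *.
split; [rewrite PE|rewrite QE].
  by rewrite (_ : (evIm Q)%:P = b%:P * u2 - 'X * v2); [ring|rewrite uE2 addrK].
by rewrite (_ : (evIm P)%:P = b%:P * u1 - 'X * v1); [ring|rewrite uE1 addrK].
Qed.

(** The diagonal Christoffel-Darboux kernel at [ib], up to degree [n - 1]. *)
Definition kernel_sum n := \sum_(k < n) (A k ^+ 2 + B k ^+ 2) / sqnorm k.

(** Christoffel-Darboux for the imaginary part of [p_(n+1) (ib)] times the conjugate of [p_n (ib)]:
    the [alpha] terms cancel, and [beta] passes the Wronskian on with the factor [h_(n+1) / h_n]. *)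
Lemma wronskian n : (forall k, (k <= n)%N -> sqnorm k != 0) ->
  B n.+1 * A n - A n.+1 * B n = b * sqnorm n * kernel_sum n.+1.
Proof.
have recA k : A k.+1 = - (b * B k) - alpha k * A k - beta k * evRe (ortho_prev k).
  by rewrite orthoS !evReD !evReN evReMX !evReZ.
have recB k : B k.+1 = b * A k - alpha k * B k - beta k * evIm (ortho_prev k).
  by rewrite orthoS !evImD !evImN evImMX !evImZ.
elim: n => [|n IHn] hn.
  rewrite recA recB /kernel_sum big_ord_recr/= big_ord0 /ortho_prev/= sqnorm0.
  rewrite /ortho/= -[1]/(1%:P) -[0]/(0%:P).
  rewrite !evReC !evImC !mulr0 !subr0 !add0r expr1n expr0n/= addr0.
  by rewrite !divr1 !mulr1.
rewrite (recA n.+1) (recB n.+1) /kernel_sum big_ord_recr/= !ortho_prevS -/(sqnorm n).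
have /IHn {}IHn : forall k, (k <= n)%N -> sqnorm k != 0.
  by move=> k kn; apply: hn; exact: leqW.
have [h1 h0] : sqnorm n.+1 != 0 /\ sqnorm n != 0 by split; exact: hn.
rewrite -/(kernel_sum n.+1).
rewrite [RHS](_ : _ = sqnorm n.+1 / sqnorm n * (b * sqnorm n * kernel_sum n.+1)
    + b * (A n.+1 ^+ 2 + B n.+1 ^+ 2)); last by field; rewrite h1 h0.
by rewrite -IHn; ring.
Qed.

Lemma kernel_sum_ge1 n : 1 <= kernel_sum n.+1.
Proof.
rewrite /kernel_sum big_ord_recl/= /ortho/= sqnorm0 -polyC1 evReC evImC.
rewrite expr1n expr0n/= addr0 divr1 lerDl sumr_ge0// => i _.
by rewrite divr_ge0 ?addr_ge0 ?sqr_ge0 ?sqnorm_ge0.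
Qed.

Lemma sum_sq_orthogonal n (c : nat -> R) :
  (forall k, (k < n)%N -> sqnorm k != 0) ->
  L ((\sum_(k < n) c k *: ortho k) * (\sum_(k < n) c k *: ortho k)) =
  \sum_(k < n) c k ^+ 2 * sqnorm k.
Proof.
move=> hn; rewrite mulr_suml L_sum; apply: eq_bigr => i _.
rewrite -scalerAl LZ mulr_sumr L_sum (bigD1 i)//= big1 ?addr0.
  by rewrite -scalerAr LZ mulrA expr2.
move=> j ji; rewrite -scalerAr LZ; apply/eqP; rewrite mulf_eq0; apply/orP; right.
have oij (k l : 'I_n) : (k < l)%N -> L (ortho l * ortho k) = 0.
  by move=> kl; apply: (@orthogonal n) => //; rewrite kl ltnW.
have [ij|ij|/val_inj/eqP] := ltngtP j i; last by rewrite (negbTE ji).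
  by rewrite oij.
by rewrite mulrC oij.
Qed.

(* The square norm of the normalised kernel polynomial
   [sum_k conj (pi_k (ib)) pi_k / h_k] is the inverse of [kernel_sum]. *)
Lemma approx_kernel n : (forall k, (k <= n)%N -> sqnorm k != 0) ->
  exists P Q : {poly R}, [/\ evRe P - evIm Q = 1, evIm P + evRe Q = 0 &
    L (P * P) + L (Q * Q) = (kernel_sum n.+1)^-1].
Proof.
move=> hn; set S := kernel_sum n.+1.
have S0 : S != 0 by rewrite gt_eqF// (lt_le_trans ltr01)// kernel_sum_ge1.
have ev0 : evRe 0 = 0 /\ evIm 0 = 0.
  by rewrite /evRe /evIm /ev rmorph0 horner0.
have evRe_sum (c : nat -> R) : evRe (\sum_(k < n.+1) c k *: ortho k) =
    \sum_(k < n.+1) c k * A k.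
  rewrite (big_morph evRe evReD ev0.1); apply: eq_bigr => k _.
  by rewrite evReZ.
have evIm_sum (c : nat -> R) : evIm (\sum_(k < n.+1) c k *: ortho k) =
    \sum_(k < n.+1) c k * B k.
  rewrite (big_morph evIm evImD ev0.2); apply: eq_bigr => k _.
  by rewrite evImZ.
have SE : S = \sum_(k < n.+1) (A k ^+ 2 + B k ^+ 2) / sqnorm k by [].
pose c k := A k / sqnorm k / S; pose e k := - B k / sqnorm k / S.
exists (\sum_(k < n.+1) c k *: ortho k), (\sum_(k < n.+1) e k *: ortho k).
rewrite !evRe_sum !evIm_sum !sum_sq_orthogonal//; split; rewrite /c /e.
- rewrite -sumrB -[RHS](divff S0) [X in _ = X / _]SE mulr_suml.
  by apply: eq_bigr => k _; ring.
- by rewrite -big_split/=; apply: big1 => k _; ring.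
- rewrite -big_split/= [RHS](_ : _ = S / S ^+ 2); last by field.
  rewrite [X in _ = X / _]SE mulr_suml.
  by apply: eq_bigr => k _ /=; field; rewrite S0 hn// -ltnS.
Qed.

Lemma kernel_sumS n : kernel_sum n.+1 = kernel_sum n + (A n ^+ 2 + B n ^+ 2) / sqnorm n.
Proof. by rewrite /kernel_sum big_ord_recr. Qed.

(** A zero at [ib] would make the Wronskian vanish, whereas it is positive. *)
Lemma ev_ortho_neq0 n : (forall k, (k <= n)%N -> sqnorm k != 0) ->
  A n.+1 ^+ 2 + B n.+1 ^+ 2 != 0.
Proof.
move=> hn; rewrite paddr_eq0 ?sqr_ge0// !sqrf_eq0; apply/negP => /andP[/eqP A0 /eqP B0].
have /eqP := wronskian hn; rewrite A0 B0 !mul0r subrr eq_sym mulf_eq0.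
rewrite gt_eqF; first by rewrite gt_eqF// (lt_le_trans ltr01)// kernel_sum_ge1.
by rewrite mulr_gt0// lt_def sqnorm_ge0 hn.
Qed.

(** A polynomial of norm 0 is divided by its nonzero value at [ib]. For integrals this is the case
    of a finitely supported measure. *)
Lemma approx_degenerate n : (forall k, (k <= n)%N -> sqnorm k != 0) ->
  sqnorm n.+1 = 0 ->
  exists P Q : {poly R}, [/\ evRe P - evIm Q = 1, evIm P + evRe Q = 0 &
    L (P * P) + L (Q * Q) = 0].
Proof.
move=> hn h0; have := ev_ortho_neq0 hn; set S := _ + _ => S0.
exists ((A n.+1 / S) *: ortho n.+1), ((- B n.+1 / S) *: ortho n.+1).
rewrite !evReZ !evImZ; split.
- rewrite -[RHS](divff S0) (_ : S / S = (A n.+1 ^+ 2 + B n.+1 ^+ 2) / S)//.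
  by ring.
- by ring.
- by rewrite -!scalerAl !LZ -!scalerAr !LZ -/(sqnorm n.+1) h0 !mulr0 addr0.
Qed.

(** The Wronskian is at least [b h_n], the kernel sum being at least 1. By AM-GM this bounds below
    the sum of two consecutive terms, and each term lies in at most two such pairs. *)
Lemma kernel_sum_lower n : (forall k, (k <= n)%N -> sqnorm k != 0) ->
  b * \sum_(k < n) Num.sqrt (sqnorm k / sqnorm k.+1) <= kernel_sum n.+1.
Proof.
move=> hn; have T0 k : 0 <= (A k ^+ 2 + B k ^+ 2) / sqnorm k.
  by rewrite divr_ge0 ?sqnorm_ge0// addr_ge0 ?sqr_ge0.
(* The last term is subtracted once: it has entered at most one pair so far. *)
suff: 2 * (b * \sum_(k < n) Num.sqrt (sqnorm k / sqnorm k.+1)) <=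
    2 * kernel_sum n.+1 - (A n ^+ 2 + B n ^+ 2) / sqnorm n.
  by have := T0 n; lra.
elim: n hn => [|n IHn] hn.
  by rewrite big_ord0 kernel_sumS /kernel_sum big_ord0; have := T0 0%N; lra.
rewrite big_ord_recr/= kernel_sumS.
have {}IHn := IHn (fun k kn => hn k (leqW kn)).
suff : 2 * (b * Num.sqrt (sqnorm n / sqnorm n.+1)) <=
    (A n ^+ 2 + B n ^+ 2) / sqnorm n + (A n.+1 ^+ 2 + B n.+1 ^+ 2) / sqnorm n.+1.
  by move: IHn; lra.
have hgt k : (k <= n.+1)%N -> 0 < sqnorm k.
  by move=> kn; rewrite lt_def sqnorm_ge0 hn.
have W : b * sqnorm n <= B n.+1 * A n - A n.+1 * B n.
  rewrite wronskian => [|k kn]; last by rewrite hn// leqW.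
  by rewrite ler_peMr ?kernel_sum_ge1// mulr_ge0 ?ltW// hgt.
rewrite sqrtrM ?sqnorm_ge0// sqrtrV ?sqnorm_ge0//.
(* With [p_n (ib) = x + iy], [p_(n+1) (ib) = x' + iy'] and [W] the Wronskian, the right side exceeds
   [2 W / (s t)] by the square modulus of [p_(n+1) (ib) / t - i p_n (ib) / s]. *)
have key (s t x y x' y' : R) : 0 < s -> 0 < t -> b * s ^+ 2 <= y' * x - x' * y ->
    2 * (b * (s / t)) <= (x ^+ 2 + y ^+ 2) / s ^+ 2 + (x' ^+ 2 + y' ^+ 2) / t ^+ 2.
  move=> s0 t0 bs; apply: (@le_trans _ _ (2 * ((y' * x - x' * y) / (s * t)))).
    rewrite ler_pM2l// ler_pdivlMr ?mulr_gt0// (_ : _ * (s * t) = b * s ^+ 2)//.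
    by field; rewrite gt_eqF.
  rewrite -subr_ge0 (_ : _ - _ = (y' / t - x / s) ^+ 2 + (x' / t + y / s) ^+ 2).
    by rewrite addr_ge0 ?sqr_ge0.
  by field; rewrite !gt_eqF.
have := key (Num.sqrt (sqnorm n)) (Num.sqrt (sqnorm n.+1)).
by rewrite !sqr_sqrtr ?sqnorm_ge0//; apply => //; rewrite sqrtr_gt0 hgt.
Qed.

End orthogonal_polynomials.

(** * Carleman's condition *)

Section hardy_carleman.
Context (R : realType).

(** Polya's weights, indexed from 0: their product telescopes, and [c k / (k + 1) = (1 + 1 / (k +
    1)) ^ (k + 1)]. *)
Let c (k : nat) : R := k.+2%:R ^+ k.+1 / k.+1%:R ^+ k.

Let c_gt0 k : 0 < c k. Proof. by rewrite divr_gt0 ?exprn_gt0. Qed.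

Let prod_c n : \prod_(k < n) c k = n.+1%:R ^+ n.
Proof.
elim: n => [|n IHn]; first by rewrite big_ord0.
by rewrite big_ord_recr/= IHn /c mulrCA divff ?mulr1// expf_neq0.
Qed.

Let c_le k : c k / k.+1%:R <= expR 1.
Proof.
have -> : c k / k.+1%:R = (1 + k.+1%:R^-1) ^+ k.+1.
  rewrite /c -mulrA -invfM -exprSr -expr_div_n; congr (_ ^+ _).
  by rewrite -[k.+2]addn1 natrD mulrDl divff// div1r.
have e1 : expR 1 = expR (k.+1%:R^-1) ^+ k.+1 :> R.
  by rewrite -expRM_natl divff.
by rewrite e1 lerXn2r ?nnegrE ?addr_ge0 ?expR_ge0// expR_ge1Dx.
Qed.

(* Weighting [a k] by [c k] makes the weighted arithmetic means summable. *)
Lemma carleman_inequality (a G : nat -> R) N :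
  (forall k, 0 <= a k) -> (forall n, 0 <= G n) ->
  (forall n, (n < N)%N -> G n ^+ n.+1 <= \prod_(k < n.+1) a k) ->
  \sum_(n < N) G n <= expR 1 * \sum_(k < N) a k.
Proof.
move=> a0 G0 Ga.
(* The difference of inverses is the telescoped sum of [1 / ((n + 1) (n + 2))] for [k <= n < N]. *)
suff: \sum_(n < N) G n <=
    \sum_(k < N) c k * a k * (k.+1%:R^-1 - N.+1%:R^-1).
  move=> /le_trans; apply; rewrite mulr_sumr; apply: ler_sum => k _.
  rewrite -mulrA mulrCA mulrC ler_wpM2r//.
  apply: (le_trans _ (c_le k)); apply: ler_wpM2l; first exact: ltW.
  by rewrite gerBl invr_ge0.
elim: N Ga => [|N IHN] Ga; first by rewrite !big_ord0.
rewrite big_ord_recr/=.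
apply: le_trans (lerD (IHN (fun n nN => Ga n (ltnW nN))) (lexx _)) _.
(* AM-GM for the [c k * a k], whose weights have product [(N + 2) ^ (N + 1)]. *)
have key : G N <= (\sum_(k < N.+1) c k * a k) * (N.+1%:R^-1 - N.+2%:R^-1).
  have -> : N.+1%:R^-1 - N.+2%:R^-1 = N.+1%:R^-1 / N.+2%:R :> R.
    rewrite -[N.+2]addn1 natrD; have : 0 < N.+1%:R :> R by [].
    by move: N.+1%:R => x x0; field; rewrite !gt_eqF ?addr_gt0.
  rewrite mulrA ler_pdivlMr// -(@ler_pXn2r _ N.+1)// ?nnegrE.
  - rewrite exprMn -(@prod_c N.+1).
    apply: (@le_trans _ _ (\prod_(k < N.+1) (c k * a k))).
      rewrite [leRHS]big_split [leLHS]mulrC; apply: ler_wpM2l; last exact: Ga.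
      by apply: prodr_ge0 => k _; exact: ltW.
    have := @leif_AGM R 'I_N.+1 predT (fun k => c k * a k).
    rewrite cardE size_enum_ord => AG; apply: AG => k _.
    by rewrite mulr_ge0// ltW.
  - by rewrite mulr_ge0.
  - by rewrite divr_ge0// sumr_ge0// => k _; rewrite mulr_ge0// ltW.
apply: le_trans (lerD (lexx _) key) _.
rewrite mulr_suml !big_ord_recr/= addrA -big_split/= lerD//.
  by apply: ler_sum => k _; rewrite -mulrDr addrA subrK.
Qed.

End hardy_carleman.

(** * Integration of polynomials as a positive functional *)

Section moment_functional.
Context (R : realType) (m : probability R R).
Hypothesis m_int : forall k, m.-integrable setT (fun x => (x ^+ k)%:E).

Lemma integrable_horner (p : {poly R}) :
  m.-integrable setT (EFin \o (fun x => p.[x])).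
Proof.
have := @integrable_sum _ _ R m setT measurableT _
  (index_enum 'I_(size p)) predT (fun i x => (p`_i)%:E * (x ^+ i)%:E)%E.
move/(_ (fun i _ => integrableZl measurableT p`_i (m_int i))).
apply: eq_integrable => // x _.
by rewrite /= horner_coef -sumEFin; apply: eq_bigr => i _; rewrite EFinM.
Qed.

Lemma Rintegral_horner_linear c (p q : {poly R}) :
  \int[m]_x (c *: p + q).[x] = c * \int[m]_x p.[x] + \int[m]_x q.[x].
Proof.
under eq_Rintegral do rewrite hornerD hornerZ.
rewrite RintegralD//; last exact: integrable_horner.
  by rewrite RintegralZl//; exact: integrable_horner.
have := integrable_horner (c *: p); apply: eq_integrable => // x _ /=.
by rewrite hornerZ.
Qed.

Lemma Rintegral_horner (p : {poly R}) :
  \int[m]_x p.[x] = \sum_(i < size p) p`_i * moment m i.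
Proof.
have D (f g : {poly R}) : \int[m]_x (f + g).[x] = \int[m]_x f.[x] + \int[m]_x g.[x].
  by have := Rintegral_horner_linear 1 f g; rewrite scale1r mul1r.
have D0 : \int[m]_x (0 : {poly R}).[x] = 0.
  by under eq_Rintegral do rewrite horner0; rewrite Rintegral_cst// mul0r.
rewrite -[in LHS](coefK p) poly_def.
rewrite (big_morph (fun q : {poly R} => \int[m]_x q.[x]) D D0).
apply: eq_bigr => i _; rewrite -[p`_i *: _]addr0 Rintegral_horner_linear D0 addr0.
by congr (_ * _); apply: eq_Rintegral => x _; rewrite hornerXn.
Qed.

Lemma Rintegral_horner_sqr_ge0 (p : {poly R}) : 0 <= \int[m]_x (p * p).[x].
Proof. by apply: Rintegral_ge0 => x _; rewrite hornerM -expr2 sqr_ge0. Qed.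

End moment_functional.

(* [P + iQ] runs over the complex polynomials with value 1 at [ib]. *)
Theorem carleman_approx (R : realType) (m : probability R R) (b e : R) :
  carleman m -> 0 < b -> 0 < e ->
  exists u v : {poly R}, let P := 1 - 'X * u - b *: v in
    let Q := b *: u - 'X * v in
    \int[m]_x (P * P).[x] + \int[m]_x (Q * Q).[x] < e.
Proof.
move=> [m_int m_oo] b0 e0; pose L (p : {poly R}) := \int[m]_x p.[x].
have L_lin c (p q : {poly R}) : L (c *: p + q) = c * L p + L q.
  exact: Rintegral_horner_linear.
have L_ge0 (p : {poly R}) : 0 <= L (p * p) by exact: Rintegral_horner_sqr_ge0.
have L1 : L 1 = 1.
  rewrite /L; under eq_Rintegral do rewrite hornerC.
  rewrite Rintegral_cst// [X in fine X](_ : _ = 1%E) ?mul1r//.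
  exact: probability_setT.
suff [P [Q [e1 e2 PQ]]] : exists P Q : {poly R},
    [/\ evRe b P - evIm b Q = 1, evIm b P + evRe b Q = 0 &
        L (P * P) + L (Q * Q) < e].
  by have [u [v [PE QE]]] := approx_of_ev e1 e2; exists u, v; rewrite /= PE QE.
(* If some norm vanishes, the first one gives error 0; index 0 is excluded as [sqnorm L 0 = 1]. *)
have [hex|nex] := pselect (exists n, sqnorm L n == 0).
  case: (ex_minnP hex) => n /eqP hn0 nmin.
  have hk k : (k < n)%N -> sqnorm L k != 0.
    by move=> kn; apply/negP => /nmin; rewrite leqNgt kn.
  case: n hn0 {nmin} hk => [|n] hn0 hk.
    by move: hn0; rewrite (sqnorm0 L1) => /eqP; rewrite oner_eq0.
  have [P [Q [e1 e2 PQ0]]] := approx_degenerate L_lin L_ge0 L1 b0 hk hn0.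
  by exists P, Q; split => //; rewrite PQ0.
have hk k : sqnorm L k != 0 by apply/negP => h0; apply: nex; exists k.
have h_gt0 k : 0 < sqnorm L k by rewrite lt_def hk sqnorm_ge0.
have L_mom n : sqnorm L n <= moment m (2 * n).
  rewrite (le_trans (sqnorm_le L_lin L_ge0 (fun k _ => hk k)))// /L.
  by under eq_Rintegral do rewrite hornerXn.
have mom_gt0 n : 0 < moment m (2 * n) := lt_le_trans (h_gt0 n) (L_mom n).
(* The product of the [a k] telescopes to [h_n^(-1/2)], and [G] holds the terms of Carleman's
   series; [h_j <= mu_(2j)] puts them below the geometric means of [a]. *)
pose a k := Num.sqrt (sqnorm L k / sqnorm L k.+1).
pose G j := (moment m (2 * j) `^ (2 * j)%:R^-1)^-1.
have prod_a n : \prod_(k < n) a k = (Num.sqrt (sqnorm L n))^-1.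
  elim: n => [|n IHn]; first by rewrite big_ord0 (sqnorm0 L1) sqrtr1 invr1.
  rewrite big_ord_recr/= IHn /a sqrtrM ?sqnorm_ge0// sqrtrV ?sqnorm_ge0// mulKf//.
  by rewrite gt_eqF// sqrtr_gt0.
have G_ge0 j : 0 <= G j by rewrite invr_ge0 powR_ge0.
have GX j : G j.+1 ^+ j.+1 <= \prod_(k < j.+1) a k.
  rewrite prod_a exprVn lef_pV2 ?posrE ?sqrtr_gt0 ?exprn_gt0 ?powR_gt0//.
  rewrite -[leRHS]ger0_norm ?exprn_ge0 ?powR_ge0// -sqrtr_sqr ler_wsqrtr//.
  rewrite -exprM (mulnC j.+1 2) -powR_mulrn ?powR_ge0// -powRrM mulVf ?powRr1 ?L_mom//.
  exact: ltW.
(* This threshold makes the kernel sum exceed [1 / e], since it is at least [b / expR 1] times the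
   sum of the [G]. *)
have [N GN] : exists N, expR 1 / (b * e) < \sum_(j < N) G j.+1.
  apply: contrapT => /forallNP Gle.
  suff : (\sum_(1 <= j <oo) ((moment m (2 * j) `^ (2 * j)%:R^-1)%:E)^-1 <=
      (expR 1 / (b * e))%:E)%E by rewrite m_oo.
  have GE j : (1 <= j)%N ->
      (((moment m (2 * j) `^ (2 * j)%:R^-1)%:E)^-1 = (G j)%:E)%E.
    by move=> _; rewrite inver gt_eqF// powR_gt0.
  apply: lime_le.
    apply: is_cvg_nneseries => j j1 _; rewrite GE// lee_fin; exact: G_ge0.
  apply: nearW => n; case: n => [|n].
    by rewrite big_geq// lee_fin divr_ge0 ?expR_ge0// ltW// mulr_gt0.
  rewrite (eq_big_nat _ _ (F2 := fun j => (G j)%:E)); last first.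
    by move=> j /andP[j1 _]; rewrite GE.
  rewrite sumEFin lee_fin big_add1/= big_mkord leNgt; apply/negP.
  exact: Gle.
have hN k : (k <= N)%N -> sqnorm L k != 0 by move=> _; exact: hk.
have [P [Q [e1 e2 PQ]]] := approx_kernel L_lin L_ge0 L1 b hN.
exists P, Q; split => //; rewrite PQ.
have kN : e^-1 < kernel_sum L b N.+1.
  have := kernel_sum_lower L_ge0 L1 b0 hN.
  apply: lt_le_trans.
  have := @carleman_inequality R a (fun j => G j.+1) N (fun k => sqrtr_ge0 _)
    (fun j => G_ge0 j.+1) (fun j _ => GX j).
  move=> /(lt_le_trans GN); rewrite ltr_pM2l ?expR_gt0//.
  by rewrite invfM ltr_pdivrMl.
rewrite -[ltRHS]invrK ltf_pV2 ?posrE ?invr_gt0//.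
by rewrite (lt_trans _ kN)// invr_gt0.
Qed.

Local Notation hE :=
  (hornerD, hornerN, hornerM, hornerZ, hornerX, hornerXn, hornerC, horner_exp).

(** * Approximation by rational polynomials *)

Section polynomial_approximation.
Context (R : realType) (m : probability R R).
Hypothesis m_int : forall k, m.-integrable setT (fun x => (x ^+ k)%:E).
Local Notation L p := (\int[m]_x p.[x]).

Lemma le_Rintegral_horner (p q : {poly R}) :
  (forall x, p.[x] <= q.[x]) -> L p <= L q.
Proof. by move=> pq; apply: le_Rintegral => //; exact: integrable_horner. Qed.

Let LD (p q : {poly R}) : L (p + q) = L p + L q.
Proof. by have := Rintegral_horner_linear m_int 1 p q; rewrite scale1r mul1r. Qed.

Let LZ c (p : {poly R}) : L (c *: p) = c * L p.
Proof.
have := Rintegral_horner_linear m_int c p 0; rewrite addr0 => ->.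
under [X in _ + X]eq_Rintegral do rewrite horner0.
by rewrite Rintegral_cst// mul0r addr0.
Qed.

(** Induction on the coefficients: in [p * 'X + c], [p] is approximated with the weight [W X^2], and
    [c] by a nearby rational. *)
Lemma rational_density (W p : {poly R}) (e : R) :
  (forall x, 0 <= W.[x]) -> 0 < e ->
  exists q : {poly rat}, L (W * (p - map_poly ratr q) ^+ 2) < e.
Proof.
elim/poly_ind: p W e => [|p c IHp] W e W0 e0.
  exists 0; rewrite rmorph0 subr0 expr0n mulr0.
  by under eq_Rintegral do rewrite horner0; rewrite Rintegral_cst// mul0r.
have WX0 x : 0 <= (W * 'X ^+ 2).[x].
  by rewrite hornerM hornerXn mulr_ge0 ?sqr_ge0.
have e4 : 0 < e / 4 by rewrite divr_gt0.
have [q Lq] := IHp (W * 'X ^+ 2) (e / 4) WX0 e4.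
have LW0 : 0 <= L W by apply: Rintegral_ge0 => x _; exact: W0.
have LW1 : 0 < L W + 1 by rewrite ltr_pwDr.
(* The bound 1 gives [(c - a)^2 <= h], the other one [h * L W <= e / 4]; the [+ 1] covers
   [L W = 0]. *)
pose h := Num.min 1 (e / 4 / (L W + 1)).
have h0 : 0 < h by rewrite lt_min ltr01 divr_gt0.
have [a] := rat_in_itvoo (ltac:(by rewrite ltrDl) : c < c + h).
rewrite in_itv/= => /andP[ca ach].
exists (q * 'X + a%:P).
rewrite rmorphD rmorphM /= map_polyX map_polyC/=.
set r : {poly R} := map_poly ratr q in Lq *.
apply: (@le_lt_trans _ _
    (L (2 *: (W * 'X ^+ 2 * (p - r) ^+ 2) + (2 * (c - ratr a) ^+ 2) *: W))).
  apply: le_Rintegral_horner => x; rewrite !hE.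
  have := W0 x; set w := W.[x]; move=> w0.
  rewrite -subr_ge0 (_ : _ - _ = w * ((p.[x] - r.[x]) * x - (c - ratr a)) ^+ 2).
    by rewrite mulr_ge0 ?sqr_ge0.
  ring.
rewrite LD !LZ.
have {}ach : (c - ratr a) ^+ 2 <= h.
  have ch : `|c - ratr a| <= h by rewrite ler_norml; apply/andP; split; lra.
  rewrite -real_normK ?num_real// expr2 (le_trans _ ch)//.
  by rewrite ler_piMl// (le_trans ch)// ge_min lexx.
have hLW : h * L W <= e / 4.
  apply: (@le_trans _ _ (e / 4 / (L W + 1) * (L W + 1)));
    last by rewrite divfK// gt_eqF.
  by apply: ler_pM => //; rewrite ?ge_min ?lexx ?orbT ?lerDl// ltW.
have := le_trans (ler_wpM2r LW0 ach) hLW.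
lra.
Qed.

(** Rational polynomials make the family countable. Perturbing [u + iv] costs the weight
    [x^2 + b^2 = |x - ib|^2], and [2 (e/8 + e/8 + e/8) < e]. *)
Lemma carleman_rational_approx (b e : R) : carleman m -> 0 < b -> 0 < e ->
  exists u v : {poly rat},
    let P := 1 - 'X * map_poly ratr u - b *: map_poly ratr v in
    let Q := b *: map_poly ratr u - 'X * map_poly ratr v in
    L (P * P + Q * Q) < e.
Proof.
move=> mc b0 e0; have e8 : 0 < e / 8 by rewrite divr_gt0.
have [u [v /= uv]] := carleman_approx mc b0 e8.
pose W : {poly R} := 'X ^+ 2 + (b ^+ 2)%:P.
have W0 x : 0 <= W.[x].
  by rewrite /W !hE addr_ge0 ?sqr_ge0.
have [u' uu'] := rational_density u W0 e8.
have [v' vv'] := rational_density v W0 e8.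
exists u', v' => /=.
move: uu' vv'; set u1 : {poly R} := map_poly ratr u'.
set v1 : {poly R} := map_poly ratr v' => uu' vv'.
move: uv; set P := 1 - _ - _; set Q := _ - _; rewrite -LD => uv.
apply: (@le_lt_trans _ _ (L (2 *: (P * P + Q * Q) +
    2 *: (W * (u - u1) ^+ 2 + W * (v - v1) ^+ 2)))).
  apply: le_Rintegral_horner => x; rewrite /P /Q /W -polyC1 !hE.
  set U := u.[x]; set V := v.[x]; set U1 := u1.[x]; set V1 := v1.[x].
  rewrite -subr_ge0 (_ : _ - _ =
    (1 - x * (2 * U - U1) - b * (2 * V - V1)) ^+ 2 +
    (b * (2 * U - U1) - x * (2 * V - V1)) ^+ 2); last by ring.
  by rewrite addr_ge0 ?sqr_ge0.
rewrite LD !LZ (LD (W * _)); lra.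
Qed.

End polynomial_approximation.

(** Countability of [J] replaces a measurable choice of the index: [{f < c}] is the union of the
    sets [{g j + e j < c}]. *)
Lemma measurable_fun_approx d (T : measurableType d) (R : realType)
    (J : countType) (f : T -> R) (g e : J -> T -> R) :
  (forall j, measurable_fun setT (g j)) ->
  (forall j, measurable_fun setT (e j)) ->
  (forall j t, `|f t - g j t| <= e j t) ->
  (forall t h, 0 < h -> exists j, e j t < h) ->
  measurable_fun setT f.
Proof.
move=> mg me fge e_small.
apply: (measurability _ (RGenInftyO.measurableE R)) => // _ [_ [c ->] <-].
rewrite setTI (_ : _ @^-1` _ =
    \bigcup_j ((fun t => g j t + e j t) @^-1` `]-oo, c[)).
  apply: countable_bigcupT_measurable => // j.
  by rewrite -[X in measurable X]setTI; apply: measurable_funD.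
apply/seteqP; split=> t /=; rewrite in_itv/=.
  move=> ftc; have cf0 : 0 < (c - f t) / 2 by rewrite divr_gt0// subr_gt0.
  have [j ej] := e_small t _ cf0.
  exists j => //=; rewrite in_itv/=.
  by have := fge j t; rewrite ler_distl => /andP[? _]; lra.
move=> [j _ /=]; rewrite in_itv/= => gec.
by have := fge j t; rewrite ler_distl => /andP[? ?]; lra.
Qed.

(** * Cauchy integrals from moments *)

Section moments.
Context d (T : measurableType d) (R : realType) (M : T -> probability R R).
Hypothesis mM : forall k, measurable_fun setT (fun t => moment (M t) k).
Hypothesis M_carleman : forall t, carleman (M t).
Local Notation obs := (observable M).

Let M_int t k : (M t).-integrable setT (fun x => (x ^+ k)%:E).
Proof. by have [+ _] := M_carleman t; apply. Qed.

Let measurable_Rintegral_horner (p : {poly R}) :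
  measurable_fun setT (fun t => \int[M t]_x p.[x]).
Proof.
rewrite (_ : (fun t => _) = (fun t => \sum_(i < size p) p`_i * moment (M t) i)).
  by apply: measurable_sum => i; exact: measurable_funM.
by apply/funext => t; rewrite Rintegral_horner.
Qed.

(** The imaginary part of [1 / (x - ib)] is [b * cauchyIm b x]; its real part is [cauchyRe b x]. *)
Definition cauchyIm (b x : R) := (x ^+ 2 + b ^+ 2)^-1.
Definition cauchyRe (b x : R) := x * cauchyIm b x.

Let den_gt0 b x : 0 < b -> 0 < x ^+ 2 + b ^+ 2 :> R.
Proof. by move=> b0; rewrite ltr_wpDl ?sqr_ge0// exprn_gt0. Qed.

Lemma cauchyIm_bounded b x : 0 < b -> `|cauchyIm b x| <= b ^- 2.
Proof.
move=> b0; have d0 := den_gt0 x b0.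
rewrite ger0_norm; last by rewrite invr_ge0 ltW.
by rewrite lef_pV2 ?posrE ?exprn_gt0// lerDr sqr_ge0.
Qed.

Lemma cauchyRe_bounded b x : 0 < b -> `|cauchyRe b x| <= b^-1.
Proof.
move=> b0; have d0 := den_gt0 x b0.
rewrite normrM [X in _ * X]ger0_norm; last by rewrite invr_ge0 ltW.
rewrite ler_pdivrMr// mulrC ler_pdivlMr//.
rewrite -[x ^+ 2]real_normK ?num_real//.
by have := sqr_ge0 (`|x| - b); have := normr_ge0 x; nra.
Qed.

Let measurable_cauchyIm b : 0 < b -> measurable_fun setT (cauchyIm b).
Proof.
move=> b0; apply: continuous_measurable_fun => x; apply: cvgV.
  by rewrite gt_eqF// den_gt0.
by apply: cvgD; [exact: exprn_continuous|exact: cvg_cst].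
Qed.

Let measurable_cauchyRe b : 0 < b -> measurable_fun setT (cauchyRe b).
Proof. by move=> b0; apply: measurable_funM => //; exact: measurable_cauchyIm. Qed.

(* AM-GM turns the L2 bound of [carleman_rational_approx] into a L1 bound
   which is the integral of a polynomial. *)
Let amgm (x h : R) : 0 < h -> `|x| <= h / 2 + (2 * h)^-1 * x ^+ 2.
Proof.
move=> h0; rewrite -[x ^+ 2]real_normK ?num_real// -subr_ge0.
rewrite (_ : _ - _ = (2 * h)^-1 * (`|x| - h) ^+ 2); last by field; rewrite gt_eqF.
by rewrite mulr_ge0 ?sqr_ge0// invr_ge0 mulr_ge0// ltW.
Qed.

(** Approximations and error bounds are integrals of polynomials, thus functions of the moments; the
    countable index is a pair of rational polynomials with an AM-GM parameter [h]. *)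
Lemma measurable_Rintegral_cauchy (b : R) (f : R -> R)
    (g : {poly rat} * {poly rat} -> {poly R}) (c : R) :
  0 < b -> measurable_fun setT f -> (forall x, `|f x| <= c) ->
  (forall (uv : {poly rat} * {poly rat}) x,
    let P := 1 - 'X * map_poly ratr uv.1 - b *: map_poly ratr uv.2 in
    let Q := b *: map_poly ratr uv.1 - 'X * map_poly ratr uv.2 in
    (f x - (g uv).[x]) ^+ 2 <= b ^- 2 * (P * P + Q * Q).[x]) ->
  measurable_fun setT (fun t => \int[M t]_x f x).
Proof.
move=> b0 mf fc fg.
pose P (uv : {poly rat} * {poly rat}) : {poly R} :=
  1 - 'X * map_poly ratr uv.1 - b *: map_poly ratr uv.2.
pose Q (uv : {poly rat} * {poly rat}) : {poly R} :=
  b *: map_poly ratr uv.1 - 'X * map_poly ratr uv.2.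
pose h (j : nat) : R := j.+1%:R^-1.
pose E (j : {poly rat} * {poly rat} * nat) : {poly R} :=
  (h j.2 / 2)%:P + ((2 * h j.2)^-1 * b ^- 2) *: (P j.1 * P j.1 + Q j.1 * Q j.1).
apply: (@measurable_fun_approx _ _ _ _ _ (fun j t => \int[M t]_x (g j.1).[x])
  (fun j t => \int[M t]_x (E j).[x])) => [j|j|j t|t r r0].
- exact: measurable_Rintegral_horner.
- exact: measurable_Rintegral_horner.
- have fi : (M t).-integrable setT (EFin \o f) by exact: bounded_integrable fc.
  have gi := integrable_horner (M_int t) (g j.1).
  rewrite -RintegralB//.
  have fgi : (M t).-integrable setT (EFin \o (fun x => f x - (g j.1).[x])).
    exact: (integrableB measurableT fi gi).
  apply: le_trans (le_normr_Rintegral measurableT fgi) _.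
  apply: le_Rintegral => //.
  + exact: (integrable_norm fgi).
  + exact: integrable_horner.
  + move=> x _; have h0 : 0 < h j.2 by rewrite invr_gt0.
    apply: le_trans (amgm _ h0) _.
    rewrite /E hornerD hornerC hornerZ lerD2l -mulrA ler_wpM2l// ?fg//.
    by rewrite invr_ge0 mulr_ge0// ltW.
- have [n nr] : exists n, h n < r.
    by have [n _ /(_ n (leqnn n))] := near_infty_natSinv_lt (PosNum r0); exists n.
  have h0 : 0 < h n by rewrite invr_gt0.
  (* This accuracy makes the second term of [E] integrate to less than [h / 2]. *)
  have [u [v /= uv]] := carleman_rational_approx (M_int t) (M_carleman t) b0
    (ltac:(by rewrite mulr_gt0 ?exprn_gt0) : 0 < h n ^+ 2 * b ^+ 2).
  exists (u, v, n); rewrite /E /=.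
  have := Rintegral_horner_linear (M_int t) ((2 * h n)^-1 * b ^- 2)
    (P (u, v) * P (u, v) + Q (u, v) * Q (u, v)) (h n / 2)%:P.
  rewrite addrC => ->.
  rewrite [X in _ + X](_ : _ = h n / 2); last first.
    under eq_Rintegral do rewrite hornerC.
    rewrite Rintegral_cst// [X in fine X](_ : _ = 1%E) ?mulr1//.
    exact: probability_setT.
  have hb : 0 < (2 * h n)^-1 * b ^- 2.
    by rewrite mulr_gt0// invr_gt0 ?mulr_gt0 ?exprn_gt0.
  apply: lt_trans nr; rewrite [ltRHS]splitr ltrD2r.
  move: uv; rewrite -(ltr_pM2l hb) => /lt_le_trans; apply.
  rewrite le_eqVlt; apply/orP; left; apply/eqP.
  by field; rewrite !gt_eqF.
Qed.

(* [x P - b Q] and [b P + x Q] are the real and imaginary parts of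
   [(x + ib) (P + iQ)]. *)
Let cauchy_le (b x P Q : R) : 0 < b ->
  ((x * P - b * Q) * cauchyIm b x) ^+ 2 <= b ^- 2 * (P * P + Q * Q).
Proof.
move=> b0; have d0 := den_gt0 x b0.
apply: (@le_trans _ _ (cauchyIm b x * (P * P + Q * Q))); last first.
  rewrite ler_wpM2r ?addr_ge0 -?expr2 ?sqr_ge0//.
  by rewrite lef_pV2 ?posrE ?exprn_gt0// lerDr sqr_ge0.
rewrite -subr_ge0 (_ : _ - _ = ((b * P + x * Q) * cauchyIm b x) ^+ 2).
  exact: sqr_ge0.
by rewrite /cauchyIm; field; rewrite gt_eqF.
Qed.

(** Since [1 / (x - ib) - (u + iv) = (P + iQ) / (x - ib)], [cauchy_le] bounds the real part of the
    error. *)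
Lemma observable_cauchyRe b : 0 < b -> obs (cauchyRe b).
Proof.
move=> b0; split.
- exact: measurable_cauchyRe.
- by exists b^-1 => x; exact: cauchyRe_bounded.
apply: (@measurable_Rintegral_cauchy b _ (fun uv => map_poly ratr uv.1) b^-1 b0).
- exact: measurable_cauchyRe.
- by move=> x; exact: cauchyRe_bounded.
- move=> uv x /=; rewrite -polyC1 !hE; have d0 := den_gt0 x b0.
  set u := (map_poly ratr uv.1).[x]; set v := (map_poly ratr uv.2).[x].
  have := cauchy_le x (1 - x * u - b * v) (b * u - x * v) b0.
  congr (_ ^+ 2 <= _); rewrite /cauchyRe /cauchyIm.
  by field; rewrite gt_eqF.
Qed.

Lemma observable_cauchyIm b : 0 < b -> obs (cauchyIm b).
Proof.
move=> b0; apply: (@eq_observable _ _ _ _ (fun x => b^-1 * (b * cauchyIm b x))).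
  by move=> x; rewrite mulKf// gt_eqF.
apply: observableZ; split.
- by apply: measurable_funM => //; exact: measurable_cauchyIm.
- exists (b * b ^- 2) => x; rewrite normrM gtr0_norm// ler_pM2l//.
  exact: cauchyIm_bounded.
apply: (@measurable_Rintegral_cauchy b _ (fun uv => map_poly ratr uv.2)
  (b * b ^- 2) b0).
- by apply: measurable_funM => //; exact: measurable_cauchyIm.
- move=> x; rewrite normrM gtr0_norm// ler_pM2l//.
  exact: cauchyIm_bounded.
- move=> uv x /=; rewrite -polyC1 !hE; have d0 := den_gt0 x b0.
  set u := (map_poly ratr uv.1).[x]; set v := (map_poly ratr uv.2).[x].
  (* With [(Q, - P)] for [(P, Q)], [cauchy_le] bounds the imaginary part. *)
  have := cauchy_le x (b * u - x * v) (- (1 - x * u - b * v)) b0.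
  rewrite mulrNN [in leRHS]addrC; congr (_ ^+ 2 <= _); rewrite /cauchyIm.
  by field; rewrite gt_eqF.
Qed.

Let cauchyIm_cvg b x : 0 < b ->
  cauchyIm (b + n.+1%:R^-1) x @[n --> \oo] --> cauchyIm b x.
Proof.
move=> b0; apply: cvgV; first by rewrite gt_eqF// den_gt0.
apply: cvgD; first exact: cvg_cst.
rewrite [X in _ --> X](_ : _ = (b + 0) * (b + 0)); last by rewrite addr0 expr2.
under eq_fun do rewrite expr2.
by apply: cvgM; apply: cvgD; (try exact: cvg_cst); exact: cvg_harmonic.
Qed.

(* [1 / ((x^2 + b^2) (x^2 + c^2))] is a difference quotient of
   [1 / (x^2 + b^2)] in [b^2], and the case [c = b] is a limit. *)
Let observable_mul (h p : R -> R) (b c : R) : 0 < b -> 0 < c ->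
  obs (fun x => h x * (p x * cauchyIm b x)) ->
  (forall c, 0 < c -> obs (fun x => h x * (p x * cauchyIm c x))) ->
  obs (fun x => h x * (p x * cauchyIm b x) * cauchyIm c x).
Proof.
move=> b0 c0 ob oc.
have neq c' : 0 < c' -> c' != b ->
    obs (fun x => h x * (p x * cauchyIm b x) * cauchyIm c' x).
  move=> c'0 cb.
  apply: eq_observable (observableZ (c' ^+ 2 - b ^+ 2)^-1
    (observableB ob (oc _ c'0))) => x.
  have db := den_gt0 x b0; have dc := den_gt0 x c'0.
  have cb0 : c' ^+ 2 - b ^+ 2 != 0.
    by rewrite subr_eq0 eqrXn2 ?ltW.
  by rewrite /cauchyIm; field; rewrite cb0 !gt_eqF.
have [->|cb] := eqVneq c b; last exact: neq.
have [_ [C hC] _] := ob.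
apply: (@observable_cvg _ _ _ _
   (fun n x => h x * (p x * cauchyIm b x) * cauchyIm (b + n.+1%:R^-1) x) _
   (C * b ^- 2)).
- move=> n; apply: neq; first by rewrite addr_gt0.
  by rewrite -subr_eq0 addrAC subrr add0r invr_neq0.
- move=> n x; rewrite normrM ler_pM//.
  apply: le_trans (cauchyIm_bounded _ _) _; first by rewrite addr_gt0.
  rewrite lef_pV2 ?posrE ?exprn_gt0 ?addr_gt0//.
  by rewrite lerXn2r ?nnegrE ?addr_ge0 ?lerDl// ltW.
- by move=> x; apply: cvgM; [exact: cvg_cst|exact: cauchyIm_cvg].
Qed.

(** The induction carries the factors [cauchyIm c x] and [x * cauchyIm c x] for all [c], so that
    [observable_mul] can absorb a second Cauchy kernel. *)
Lemma observable_cauchyReX b k : 0 < b -> obs (fun x => cauchyRe b x ^+ k).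
Proof.
move=> b0.
suff: [/\ obs (fun x => cauchyRe b x ^+ k),
   forall c, 0 < c -> obs (fun x => cauchyRe b x ^+ k * (1 * cauchyIm c x)) &
   forall c, 0 < c -> obs (fun x => cauchyRe b x ^+ k * (x * cauchyIm c x))].
  by case.
elim: k => [|k [IH IHi IHr]].
  split=> [|c c0|c c0]; first exact: observable_cst.
    by apply: eq_observable (observable_cauchyIm c0) => x; rewrite !mul1r.
  by apply: eq_observable (observable_cauchyRe c0) => x; rewrite !mul1r.
split=> [|c c0|c c0].
- by apply: eq_observable (IHr b b0) => x; rewrite exprSr.
- apply: eq_observable (observable_mul b0 c0 (IHr b b0) IHr) => x.
  by rewrite exprSr mul1r /cauchyRe.
(* Here [x^2 / (x^2 + b^2) = 1 - b^2 / (x^2 + b^2)]. *)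
- apply: eq_observable (observableB (IHi c c0) (observableZ (b ^+ 2)
    (observable_mul b0 c0 (IHi b b0) IHi))) => x.
  have db := den_gt0 x b0; have dc := den_gt0 x c0.
  rewrite [in RHS]exprSr; move: (cauchyRe b x ^+ k) => z.
  by rewrite /cauchyRe /cauchyIm; field; rewrite !gt_eqF.
Qed.

Theorem measurable_eval_moment B : measurable B ->
  measurable_fun setT (fun t => M t B).
Proof.
apply: (measurable_eval_preimage
  (F := fun n x => n.+1%:R ^+ 2 * cauchyRe n.+1%:R x) (g := idfun)) => [x|n k].
  under eq_fun => n.
    rewrite (_ : _ * _ = x * (x * n.+1%:R^-1 * (x * n.+1%:R^-1) + 1)^-1).
      over.
    have n0 : 0 < n.+1%:R :> R by [].
    have dn := den_gt0 x n0; rewrite /cauchyRe /cauchyIm.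
    by move: n.+1%:R n0 dn => y y0 dy; field; rewrite -expr2 !gt_eqF.
  have -> : idfun x = x * (x * 0 * (x * 0) + 1)^-1.
    by rewrite !mulr0 add0r invr1 mulr1.
  apply: cvgMr; apply: cvgV; first by rewrite !mulr0 add0r oner_neq0.
  apply: cvgD; last exact: cvg_cst.
  by apply: cvgM; apply: cvgMr; exact: cvg_harmonic.
apply: eq_observable (observableZ ((n.+1%:R ^+ 2) ^+ k)
  (observable_cauchyReX k (ltr0Sn R n))) => x.
by rewrite [RHS]exprMn.
Qed.

End moments.

(** * Moment generating functions *)

Lemma nneseries_harmonic (R : realType) (c : R) : 0 < c ->
  (\sum_(1 <= j <oo) (c%:E * (j%:R^-1)%:E) = +oo)%E.
Proof.
move=> c0; apply/eqP; apply: contrapT => /negP Soo.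
have F0 j : (0 <= c%:E * (j%:R^-1)%:E)%E.
  by rewrite -EFinM lee_fin mulr_ge0 ?invr_ge0 ?(ltW c0).
set S := limn _ in Soo.
have S0 : (0 <= S)%E by apply: nneseries_ge0 => j _ _; exact: F0.
have Sfin : S \is a fin_num by rewrite ge0_fin_numE// ltey.
apply: (@dvg_harmonic R); apply: nondecreasing_is_cvgn.
  by apply: nondecreasing_series => k _ _; exact: harmonic_ge0.
exists (fine S / c) => _ [n _ <-].
rewrite ler_pdivlMr// mulrC -lee_fin fineK//.
apply: le_trans (nneseries_lim_ge n.+1 (fun j _ _ => F0 j)).
rewrite big_add1/= /series/= mulr_sumr -sumEFin.
by apply: lee_sum => j _; rewrite EFinM.
Qed.

Section exponential_moments.
Context (R : realType) (m : probability R R) (r : R).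
Hypothesis r_gt0 : 0 < r.
Hypothesis expr_int : m.-integrable setT (fun x => (expR (r * `|x|))%:E).

Lemma exp_dominated_integrable (f : R -> R) (C : R) :
  measurable_fun setT f -> (forall x, `|f x| <= C * expR (r * `|x|)) ->
  m.-integrable setT (EFin \o f).
Proof.
move=> mf fC.
apply: (le_integrable measurableT _ _ (integrableZl measurableT C expr_int)).
  exact/measurable_EFinP.
by move=> x _; rewrite -EFinM !abse_EFin lee_fin (le_trans (fC x))// ler_norm.
Qed.

Lemma exprn_le_expR (n : nat) (x : R) :
  `|x ^+ n| <= n`!%:R * r ^- n * expR (r * `|x|).
Proof.
have rx : 0 <= r * `|x| by rewrite mulr_ge0// ltW.
case: n => [|n].
  by rewrite expr0 normr1 invr1 !mul1r -expR0 ler_expR.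
have := expR_ge1Dxn n rx; set e := expR _ => le_e.
have {le_e} : (r * `|x|) ^+ n.+1 / (n.+1)`!%:R <= e by lra.
rewrite ler_pdivrMr ?ltr0n ?fact_gt0// exprMn -normrX mulrC -ler_pdivlMr ?exprn_gt0//.
by move=> /le_trans; apply; rewrite [leRHS]mulrC mulrA.
Qed.

Lemma exp_moment_integrable n : m.-integrable setT (fun x => (x ^+ n)%:E).
Proof.
apply: (@exp_dominated_integrable (fun x => x ^+ n)) (exprn_le_expR n).
exact: measurable_funX.
Qed.

Lemma fact_le_expn n : (n`! <= n ^ n)%N.
Proof.
elim: n => // n IHn; rewrite factS expnS leq_mul2l/= (leq_trans IHn)//.
by case: n {IHn} => // n; rewrite leq_exp2r.
Qed.

(** From [n! <= n^n] and [1 <= K] follows [mu_n <= (n K / r)^n] for positive [n], so Carleman's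
    series dominates a harmonic one. *)
Lemma exp_moment_carleman : carleman m.
Proof.
split; first exact: exp_moment_integrable.
pose K := \int[m]_x expR (r * `|x|).
have m1 : \int[m]_x (1 : R) = 1.
  rewrite Rintegral_cst// [X in fine X](_ : _ = 1%E) ?mulr1//.
  exact: probability_setT.
have K1 : 1 <= K.
  rewrite -m1; apply: le_Rintegral => //.
    by apply: (@bounded_integrable _ m (cst 1) 1) => // x; rewrite normr1.
  by move=> x _; rewrite -expR0 ler_expR mulr_ge0// ltW.
have K0 : 0 < K by apply: lt_le_trans K1.
have mom_le n : moment m n.+1 <= (n.+1%:R * K / r) ^+ n.+1.
  apply: (@le_trans _ _ ((n.+1)`!%:R * r ^- n.+1 * K)).
    rewrite -RintegralZl//; apply: le_Rintegral => //.
    + exact: exp_moment_integrable.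
    + have := integrableZl measurableT ((n.+1)`!%:R * r ^- n.+1) expr_int.
      by apply: eq_integrable => // x _; rewrite /= EFinM.
    + by move=> x _; rewrite (le_trans (ler_norm _))// exprn_le_expR.
  rewrite mulrAC !exprMn exprVn; apply: ler_wpM2r.
    by rewrite invr_ge0 exprn_ge0// ltW.
  apply: ler_pM; rewrite ?ler0n//; first exact: ltW.
    by rewrite -natrX ler_nat fact_le_expn.
  by rewrite ler_eXnr.
have key j : (((r / (2 * K))%:E * (j%:R^-1)%:E) <=
    ((moment m (2 * j) `^ (2 * j)%:R^-1)%:E)^-1)%E.
  rewrite inver; case: ifPn => [_|mj]; first by rewrite leey.
  case: j mj => [|j] mj; first by rewrite invr0 mule0 lee_fin invr_ge0 powR_ge0.
  rewrite -EFinM lee_fin.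
  have p0 : 0 < moment m (2 * j.+1) `^ (2 * j.+1)%:R^-1.
    by rewrite lt_def mj powR_ge0.
  have -> : r / (2 * K) / j.+1%:R = ((2 * j.+1)%:R * K / r)^-1.
    by rewrite natrM; field; rewrite !gt_eqF.
  have c0 : 0 < (2 * j.+1)%:R * K / r by rewrite divr_gt0 ?mulr_gt0// ltr0n.
  rewrite lef_pV2 ?posrE//.
  have -> : (2 * j.+1)%:R * K / r =
      (((2 * j.+1)%:R * K / r) ^+ (2 * j.+1)) `^ (2 * j.+1)%:R^-1.
    by rewrite -powR_mulrn ?ltW// -powRrM divff ?powRr1 ?ltW.
  apply: ge0_ler_powR.
  - by rewrite invr_ge0.
  - by rewrite nnegrE; apply: Rintegral_ge0 => x _; rewrite mulnC exprM sqr_ge0.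
  - by rewrite nnegrE exprn_ge0// ltW.
  - by have := mom_le (2 * j).+1; rewrite mulnS.
apply/eqP; rewrite -leye_eq.
rewrite -(@nneseries_harmonic _ (r / (2 * K))) ?divr_gt0 ?mulr_gt0//.
apply: lee_nneseries => // j _ _.
by rewrite -EFinM lee_fin mulr_ge0 ?invr_ge0// ltW// divr_gt0 ?mulr_gt0.
Qed.

End exponential_moments.

Lemma mgfE (R : realType) (m : probability R R) (s : R) :
  mgf m s = (\int[m]_x (expR (s * x))%:E)%E.
Proof.
rewrite /mgf /mmt_gen_fun unlock; apply: eq_integral => x _ /=.
by rewrite mulrC.
Qed.

Lemma measurable_expRM (R : realType) (s : R) :
  measurable_fun setT (fun x : R => expR (s * x)).
Proof. by apply: measurableT_comp => //; exact: measurable_funM. Qed.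

Lemma mgf_integrable (R : realType) (m : probability R R) (s : R) :
  (mgf m s < +oo)%E -> m.-integrable setT (fun x => (expR (s * x))%:E).
Proof.
rewrite mgfE => fin; apply/integrableP; split.
  by apply/measurable_EFinP; exact: measurable_expRM.
by under eq_integral do rewrite abse_EFin ger0_norm ?expR_ge0//.
Qed.

(** [exp (r |x|) <= exp (r x) + exp (- r x)], with [r] half the radius of a ball of finiteness. *)
Lemma finite_mgf_exp_integrable (R : realType) (m : probability R R) :
  finite_mgf m -> exists2 r : R, 0 < r &
    m.-integrable setT (fun x => (expR (r * `|x|))%:E).
Proof.
move=> /nbhs_ballP[e /= e0 fin]; exists (e / 2); first by rewrite divr_gt0.
have e20 : 0 < e / 2 by rewrite divr_gt0.
have fin1 s : `|s| = e / 2 -> m.-integrable setT (fun x => (expR (s * x))%:E).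
  move=> se; apply/mgf_integrable/fin; rewrite -ball_normE/= sub0r normrN se.
  by rewrite ltr_pdivrMr// ltr_pMr// ltr1n.
have i1 : m.-integrable setT (fun x => (expR (e / 2 * x))%:E).
  by apply: fin1; rewrite gtr0_norm.
have i2 : m.-integrable setT (fun x => (expR (- (e / 2) * x))%:E).
  by apply: fin1; rewrite normrN gtr0_norm.
apply: (le_integrable measurableT _ _ (integrableD measurableT i1 i2)).
  apply/measurable_EFinP; apply: measurableT_comp => //.
  by apply: measurable_funM => //; exact: measurableT_comp.
move=> x _; rewrite -EFinD !abse_EFin lee_fin [leLHS]ger0_norm ?expR_ge0//.
rewrite [leRHS]ger0_norm ?addr_ge0 ?expR_ge0//.
have [x0|x0] := leP 0 x.
  by rewrite ger0_norm// lerDl expR_ge0.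
by rewrite ltr0_norm// mulrN mulNr lerDr expR_ge0.
Qed.

Lemma expR_sub1_le (R : realType) (y : R) : `|expR y - 1| <= `|y| * expR `|y|.
Proof.
have [y0|y0] := leP 0 y.
  rewrite !ger0_norm//; last by rewrite subr_ge0 -expR0 ler_expR.
  have := expR_ge1Dx (- y); rewrite -(ler_pM2l (expR_gt0 y)) -expRD subrr expR0.
  by rewrite mulrDr mulr1 mulrN; lra.
have e1 : expR y <= 1 by rewrite -expR0 ler_expR ltW.
rewrite ler0_norm ?subr_le0// ltr0_norm// opprB.
apply: (@le_trans _ _ (- y)); first by have := expR_ge1Dx y; lra.
by rewrite ler_peMr// ?oppr_ge0 ?(ltW y0)// -expR0 ler_expR oppr_ge0 ltW.
Qed.

Lemma Rintegral_sum d (T : measurableType d) (R : realType)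
    (mu : {measure set T -> \bar R}) (I : Type) (s : seq I) (F : I -> T -> R) :
  (forall i, mu.-integrable setT (EFin \o F i)) ->
  \int[mu]_x (\sum_(i <- s) F i x) = \sum_(i <- s) \int[mu]_x F i x.
Proof.
move=> Fi; elim: s => [|i s IHs].
  under eq_Rintegral do rewrite big_nil.
  rewrite big_nil /Rintegral integral0//.
under eq_Rintegral do rewrite big_cons.
rewrite RintegralD ?IHs ?big_cons//.
have := integrable_sum measurableT s (P := predT) (fun i _ => Fi i).
by apply: eq_integrable => // x _; rewrite /= sumEFin.
Qed.

(* The forward difference of step [1 / n.+1] and order [k] at 0, divided by
   the [k]-th power of the step. *)
Definition mgf_difference (R : realType) (m : probability R R) (k n : nat) : R :=
  n.+1%:R ^+ k * \sum_(i < k.+1) ((-1) ^+ i *+ 'C(k, i)) *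
    fine (mgf m ((k - i)%:R / n.+1%:R)).

Section moments_of_mgf.
Context (R : realType) (m : probability R R) (r : R) (k : nat).
Hypothesis r_gt0 : 0 < r.
Hypothesis expr_int : m.-integrable setT (fun x => (expR (r * `|x|))%:E).

Let phi n x : R := (n.+1%:R * (expR (n.+1%:R^-1 * x) - 1)) ^+ k.

(** Binomial expansion of [phi]. The condition keeps the arguments of the moment generating function
    within [r], where it is finite and [fine] loses nothing. *)
Let mgf_differenceE n : k%:R / n.+1%:R <= r ->
  mgf_difference m k n = \int[m]_x phi n x.
Proof.
move=> kn.
have i_exp (i : nat) : (i <= k)%N ->
    m.-integrable setT (fun x => (expR (i%:R / n.+1%:R * x))%:E).
  move=> ik; apply: (exp_dominated_integrable expr_int (C := 1)).
    exact: measurable_expRM.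
  move=> x; rewrite mul1r ger0_norm ?expR_ge0// ler_expR.
  apply: (le_trans (ler_norm _)); rewrite normrM ler_wpM2r// ger0_norm ?divr_ge0//.
  by rewrite (le_trans _ kn)// ler_wpM2r ?invr_ge0// ler_nat.
have i_term (i : 'I_k.+1) : m.-integrable setT (EFin \o (fun x =>
    ((-1) ^+ i *+ 'C(k, i)) * expR ((k - i)%:R / n.+1%:R * x))).
  have := integrableZl measurableT ((-1) ^+ i *+ 'C(k, i)) (i_exp _ (leq_subr i k)).
  by apply: eq_integrable => // x _; rewrite /= EFinM.
have sumE x : phi n x = n.+1%:R ^+ k * \sum_(i < k.+1)
    ((-1) ^+ i *+ 'C(k, i)) * expR ((k - i)%:R / n.+1%:R * x).
  rewrite /phi exprMn exprBn; congr (_ * _); apply: eq_bigr => i _.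
  by rewrite expr1n mulr1 mulrnAl -mulrA expRM_natl.
under eq_Rintegral do rewrite sumE.
rewrite RintegralZl//; last first.
  have := integrable_sum measurableT (index_enum 'I_k.+1) (P := predT)
    (fun i _ => i_term i).
  by apply: eq_integrable => // x _; rewrite /= sumEFin.
rewrite Rintegral_sum//; congr (_ * _); apply: eq_bigr => i _.
by rewrite RintegralZl ?mgfE// i_exp// leq_subr.
Qed.

(** [phi n x] tends to [x ^ k]. Half of the rate [r] dominates [|x| ^ k] and the other half the
    exponential factor, once [k / (n + 1) <= r / 2]; hence the shift by [N]. *)
Lemma cvg_mgf_difference : mgf_difference m k n @[n --> \oo] --> moment m k.
Proof.
have r2 : 0 < r / 2 by rewrite divr_gt0.
have [N _ Nr] := near_infty_natSinv_lt
  (PosNum (ltac:(by rewrite divr_gt0) : 0 < r / 2 / k.+1%:R)).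
have kr n : (N <= n)%N -> k%:R / n.+1%:R <= r / 2.
  move=> /Nr /= /ltW nr.
  apply: (@le_trans _ _ (k.+1%:R / n.+1%:R)).
    by rewrite ler_wpM2r ?invr_ge0// ler_nat.
  by rewrite mulrC -ler_pdivlMr.
rewrite -(cvg_shiftn N).
under eq_fun => n.
  rewrite mgf_differenceE; last first.
    by rewrite (le_trans (kr _ (leq_addl _ _)))// ler_pdivrMr// ler_pMr// ler1n.
  over.
pose C := k`!%:R * (r / 2) ^- k.
have mphi n : measurable_fun setT (phi n).
  apply: measurable_funX; apply: measurable_funM => //; apply: measurable_funB => //.
  exact: measurable_expRM.
have phi_le n x : (N <= n)%N -> `|phi n x| <= C * expR (r * `|x|).
  move=> Nn; rewrite /phi normrX.
  apply: (@le_trans _ _ ((`|x| * expR (n.+1%:R^-1 * `|x|)) ^+ k)).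
    rewrite lerXn2r ?nnegrE ?normr_ge0 ?mulr_ge0 ?expR_ge0//.
    rewrite normrM [X in X * _]ger0_norm//.
    rewrite -ler_pdivlMl//; apply: le_trans (expR_sub1_le _) _.
    by rewrite normrM [`|_^-1|]ger0_norm ?invr_ge0// mulrA.
  rewrite exprMn -normrX -expRM_natl mulrA.
  apply: (@le_trans _ _ (C * expR (r / 2 * `|x|) * expR (r / 2 * `|x|))).
    apply: ler_pM => //; rewrite ?expR_ge0//; first exact: exprn_le_expR.
    by rewrite ler_expR ler_wpM2r// kr.
  by rewrite -mulrA -expRD -mulrDl -splitr.
have iC : m.-integrable setT (fun x => (C * expR (r * `|x|))%:E).
  have := integrableZl measurableT C expr_int.
  by apply: eq_integrable => // x _; rewrite /= EFinM.
have phi_cvg x : phi n x @[n --> \oo] --> x ^+ k.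
  have := @cvg_difference_quotient R expR _ x (is_derive_expR (0 : R)).
  rewrite expR0 mul1r => cv.
  exact: (cvg_comp _ (fun y : R => y ^+ k) cv (@exprn_continuous R k x)).
have mX : measurable_fun setT (fun x : R => (x ^+ k)%:E).
  by apply/measurable_EFinP; exact: measurable_funX.
have mp n : measurable_fun setT (EFin \o phi (n + N)%N) by apply/measurable_EFinP.
have ae1 : {ae m, forall x, setT x ->
    (EFin \o phi (n + N)%N) x @[n --> \oo] --> (x ^+ k)%:E}.
  apply/aeW => x _; apply: cvg_EFin; first exact: nearW.
  by rewrite (cvg_shiftn N (phi ^~ x)); exact: phi_cvg.
have ae2 : {ae m, forall x n, setT x ->
    (`|(EFin \o phi (n + N)%N) x| <= (C * expR (r * `|x|))%:E)%E}.
  by apply/aeW => x n _; rewrite lee_fin phi_le// leq_addl.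
have [iX _ cv] := dominated_convergence measurableT mp mX ae1 iC ae2.
apply: fine_cvg; rewrite fineK; first exact: cv.
exact: integrable_fin_num.
Qed.

End moments_of_mgf.

Theorem measurable_eval_mgf d (T : measurableType d) (R : realType)
    (M : T -> probability R R) (B : set R) :
  (forall s, measurable_fun setT (fun t => mgf (M t) s)) ->
  (forall t, finite_mgf (M t)) -> measurable B ->
  measurable_fun setT (fun t => M t B).
Proof.
move=> mM M_fin; apply: measurable_eval_moment => [k|t].
  apply: (measurable_fun_cvg (h := fun n t => mgf_difference (M t) k n)) => [n|t _].
    apply: measurable_funM => //; apply: measurable_sum => i.
    by apply: measurable_funM => //; exact: measurableT_comp.
  have [r r0 ri] := finite_mgf_exp_integrable (M_fin t).
  exact: cvg_mgf_difference r0 ri.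
have [r r0 ri] := finite_mgf_exp_integrable (M_fin t).
exact: exp_moment_carleman r0 ri.
Qed.

Theorem proposition4p0p3 (R : realType) (d1 d2 : measure_display)
    (Omega1 : measurableType d1) (Omega2 : measurableType d2)
    (P : probability Omega1 R) (Q : probability Omega2 R)
    (mu : {RV P >-> pprobability R R}) (nu : {RV Q >-> pprobability R R}) :
  [\/ eq_joint_distribution P Q (fun (t : R) w => char_fun (mu w) t)
                                (fun (t : R) w => char_fun (nu w) t),
      [/\ {ae P, forall w, supported_nonneg (mu w)},
          {ae Q, forall w, supported_nonneg (nu w)} &
          eq_joint_distribution P Q (fun (s : {nonneg R}) w => laplace (mu w) s)
                                    (fun (s : {nonneg R}) w => laplace (nu w) s)],
      [/\ {ae P, forall w, finite_mgf (mu w)},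
          {ae Q, forall w, finite_mgf (nu w)} &
          eq_joint_distribution P Q (fun (s : R) w => mgf (mu w) s)
                                    (fun (s : R) w => mgf (nu w) s)] |
      [/\ {ae P, forall w, carleman (mu w)},
          {ae Q, forall w, carleman (nu w)} &
          eq_joint_distribution P Q (fun (k : nat) w => moment (mu w) k)
                                    (fun (k : nat) w => moment (nu w) k)]] ->
  eq_distribution P Q mu nu.
Proof.
case=> [eqX|[aeP aeQ eqX]|[aeP aeQ eqX]|[aeP aeQ eqX]].
(* For the characteristic function, the class of measures is the whole space. *)
- have aeT d (T : measurableType d) (m : probability T R)
      (f : T -> probability R R) : {ae m, forall w, setT (f w)} by exact: aeW.
  apply: (eq_distribution_transform (X := fun t m => char_fun m t)
    _ _ (aeT _ _ P mu) (aeT _ _ Q nu) eqX) => [t|d T M _ mM].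
    by apply: measurable_to_borelC; apply: measurable_Rintegral => //;
      apply: continuous_measurable_fun => x; apply: continuous_comp;
      (try exact: mulrl_continuous); [exact: continuous_cos|exact: continuous_sin].
  exact: measurable_eval_char_fun.
- apply: (eq_distribution_transform (X := fun s m => laplace m s)
    _ _ aeP aeQ eqX) => [s|d T M M_ge0 mM].
    apply: measurable_Rintegral => //; apply: measurableT_comp => //.
    by apply: measurableT_comp => //; exact: measurable_funM.
  exact: measurable_eval_laplace.
- apply: (eq_distribution_transform (X := fun s m => mgf m s)
    _ _ aeP aeQ eqX) => [s|d T M M_fin mM B].
    under eq_fun do rewrite mgfE.
    apply: measurable_integral => //; apply/measurable_EFinP.
    exact: measurable_expRM.
  exact: measurable_eval_mgf.
- apply: (eq_distribution_transform (X := fun k m => moment m k)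
    _ _ aeP aeQ eqX) => [k|d T M M_car mM].
    by apply: measurable_Rintegral => //; exact: measurable_funX.
  exact: measurable_eval_moment.
Qed.
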